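(* Let $A:\mathfrak{X}(M)\to\mathfrak{X}(M)$ be an operator on a differentiable manifold $M$. Assume that for some integer $m\ge 1$ $$\tau^{(m)}_{A}(X,Y)=0\qquad\text{for all } X,Y\in\mathfrak{X}(M).$$ Then each generalized eigen-distribution of $A$, as well as each direct sum of generalized eigen-distributions of $A$, is integrable.
   Context: $M$ is a smooth manifold, $\mathfrak{X}(M)$ its smooth vector fields, $[\cdot,\cdot]$ the Lie bracket. An operator is a smooth $(1,1)$ tensor field $A:\mathfrak{X}(M)\to\mathfrak{X}(M)$. Generalized Nijenhuis torsions: $\tau^{(0)}_A(X,Y):=[X,Y]$ and, for $m\ge1$, $$\tau^{(m)}_A(X,Y):=A^2\tau^{(m-1)}_A(X,Y)+\tau^{(m-1)}_A(AX,AY)-A\big(\tau^{(m-1)}_A(X,AY)+\tau^{(m-1)}_A(AX,Y)\big).$$ So $\tau^{(1)}_A$ is the Nijenhuis torsion and $\tau^{(2)}_A$ the Haantjes torsion. Standing assumptions: the distinct eigenvalues $\lambda_1(x),\dots,\lambda_s(x)$ of $A$ are real and pointwise distinct. The generalized eigen-distribution of $\lambda_i$ is $\mathcal{D}_i=\ker(A-\lambda_i I)^{\rho_i}$, where the Riesz index $\rho_i$ is the minimum integer with $\ker(A-\lambda_iI)^{\rho_i}=\ker(A-\lambda_iI)^{\rho_i+1}$; $\rho_i$ is assumed locally independent of the point. All the eigen-distributions are assumed to have constant rank on $M$; for such distributions integrability (in the sense of Frobenius) is equivalent to involutivity. ''Generalized'' includes the case $\rho_i=1$ of proper eigen-distributions.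 *)

(* Defs.v *)
From mathcomp Require Import all_boot all_order all_algebra.
From mathcomp Require Import all_classical all_reals all_analysis.
From mathcomp Require Import complex.

Set Implicit Arguments.
Unset Strict Implicit.
Unset Printing Implicit Defensive.

Import Order.TTheory GRing.Theory Num.Theory.
Import numFieldNormedType.Exports.

Local Open Scope classical_set_scope.
Local Open Scope ring_scope.

(* C^k on U in the Frechet sense; meant for an open set U of a
   finite-dimensional space, where it suffices to control the derivatives in
   each fixed direction. *)
Fixpoint Ck_on (R : realType) (V W : normedModType R) (k : nat)
    (U : set V) (f : V -> W) : Prop :=
  if k is k'.+1 then
    (forall x, U x -> differentiable f x) /\
    (forall v, Ck_on k' U (fun x => 'D_v f x))
  else forall x, U x -> {for x, continuous f}.

Definition smooth_on (R : realType) (V W : normedModType R)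
    (U : set V) (f : V -> W) : Prop := forall k, Ck_on k U f.

(* The fields [coord] and [param] are total functions; only their restrictions
   to [dom i] and to [coord i @` dom i] are meaningful, and there they are
   inverse homeomorphisms. *)
Record smooth_manifold (R : realType) (n : nat) := SmoothManifold {
  carrier :> topologicalType;
  chart : Type;
  dom : chart -> set carrier;
  coord : chart -> carrier -> 'rV[R]_n;
  param : chart -> 'rV[R]_n -> carrier;
  carrier_hausdorff : hausdorff_space carrier;
  carrier_second_countable : @second_countable carrier;
  dom_cover : forall x : carrier, exists i, dom i x;
  dom_open : forall i, open (dom i);
  coord_open : forall i, open (coord i @` dom i);
  coordK : forall i x, dom i x -> param i (coord i x) = x;
  coord_continuous : forall i x, dom i x -> {for x, continuous (coord i)};
  param_continuous : forall i u, (coord i @` dom i) u ->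
    {for u, continuous (param i)};
  transition_smooth : forall i j,
    smooth_on (coord i @` (dom i `&` dom j)) (coord j \o param i)
}.

Section TensorFields.
Variables (R : realType) (n : nat) (M : smooth_manifold R n).

(* A tangent vector at [x] is a family of components, one row vector for each
   chart around [x], obeying the contravariant transformation law; [X i x] is
   the row of components of [X] at [x] in the chart [i], and has no meaning
   when [x] is outside [dom i].  Jacobians act on row vectors, on the right. *)
Definition transition_jacobian (i j : chart M) (x : M) : 'M[R]_n :=
  jacobian (coord j \o param i) (coord i x).

Definition vector_field (X : chart M -> M -> 'rV[R]_n) : Prop :=
  (forall i j x, dom i x -> dom j x ->
     X j x = X i x *m transition_jacobian i j x) /\
  (forall i, smooth_on (coord i @` dom i) (fun u => X i (param i u))).

(* In the chart [i] the operator maps the row [v] to [v *m A i x]. *)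
Definition operator_field (A : chart M -> M -> 'M[R]_n) : Prop :=
  (forall i j x, dom i x -> dom j x ->
     A i x *m transition_jacobian i j x = transition_jacobian i j x *m A j x) /\
  (forall i, smooth_on (coord i @` dom i) (fun u => A i (param i u))).

Definition op_apply (A : chart M -> M -> 'M[R]_n)
    (X : chart M -> M -> 'rV[R]_n) : chart M -> M -> 'rV[R]_n :=
  fun i x => X i x *m A i x.

(* [X, Y]^k = X^j d_j Y^k - Y^j d_j X^k *)
Definition lie_bracket (X Y : chart M -> M -> 'rV[R]_n) :
    chart M -> M -> 'rV[R]_n :=
  fun i x => 'D_(X i x) (fun u => Y i (param i u)) (coord i x)
           - 'D_(Y i x) (fun u => X i (param i u)) (coord i x).

Fixpoint torsion (m : nat) (A : chart M -> M -> 'M[R]_n)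
    (X Y : chart M -> M -> 'rV[R]_n) : chart M -> M -> 'rV[R]_n :=
  if m is m'.+1 then
    fun i x =>
      op_apply A (op_apply A (torsion m' A X Y)) i x
      + torsion m' A (op_apply A X) (op_apply A Y) i x
      - op_apply A (fun j y => torsion m' A X (op_apply A Y) j y
                             + torsion m' A (op_apply A X) Y j y) i x
  else lie_bracket X Y.

Definition riesz_index (B : 'M[R]_n) (r : nat) : Prop :=
  (kermx (B ^+ r) == kermx (B ^+ r.+1))%MS /\
  (forall q, (kermx (B ^+ q) == kermx (B ^+ q.+1))%MS -> (r <= q)%N).

(* A distribution is given, in each chart, by matrices whose row spaces are the
   subspaces of the tangent spaces. *)
Definition eigen_distribution (A : chart M -> M -> 'M[R]_n)
    (lam : M -> R) (rho : M -> nat) : chart M -> M -> 'M[R]_n :=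
  fun i x => kermx ((A i x - (lam x)%:M) ^+ rho x).

Definition constant_rank (D : chart M -> M -> 'M[R]_n) : Prop :=
  exists r : nat, forall i x, dom i x -> \rank (D i x) = r.

(* [g] is an injective immersion of the open set [U] of R^r whose image has
   tangent space [D] at each of its points. *)
Definition integral_manifold (D : chart M -> M -> 'M[R]_n)
    (r : nat) (U : set 'rV[R]_r) (g : 'rV[R]_r -> M) : Prop :=
  [/\ open U,
      (forall u v, U u -> U v -> g u = g v -> u = v),
      (forall u, U u -> {for u, continuous g}),
      (forall i, smooth_on (U `&` g @^-1` dom i) (coord i \o g)) &
      (forall i u, U u -> dom i (g u) ->
         row_free (jacobian (coord i \o g) u) /\
         (jacobian (coord i \o g) u == D i (g u))%MS)].

Definition integrable_distribution (D : chart M -> M -> 'M[R]_n) : Prop :=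
  forall p : M, exists (r : nat) (U : set 'rV[R]_r) (g : 'rV[R]_r -> M),
    integral_manifold D U g /\ exists2 u, U u & g u = p.

End TensorFields.

(* Main.v *)
Require Import Defs.
From mathcomp Require Import all_boot all_order all_algebra.
From mathcomp Require Import all_classical all_reals all_analysis.
From mathcomp Require Import complex.
From mathcomp Require Import perm ring lra.

Set Implicit Arguments.
Unset Strict Implicit.
Unset Printing Implicit Defensive.

Import Order.TTheory GRing.Theory Num.Theory.
Import numFieldNormedType.Exports.

Local Open Scope classical_set_scope.
Local Open Scope ring_scope.

(** The idea is that modulo a sum [D] of generalized eigen-distributions the Lie
    bracket of two sections of [D] is a pointwise bilinear map, and that the
    vanishing of the torsion kills this map by linear algebra.

    Let [S] be a set of eigenvalues, [D] the sum of their generalized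
    eigenspaces and [P] the product of the [(A - lam k)^n] over [k] in [S], so
    that [D] is the kernel of [P].  If [X P = 0] and [Y P = 0], the Leibniz rule
    gives [[X, Y] P = X (d_Y P) - Y (d_X P)], which depends on the values of [X]
    and [Y] only: this is [bracket_defect].  As [P] commutes with [A], the torsion
    of order [m], multiplied by [P], is obtained from this bilinear map by
    applying [m] times the operator [(L - P1) (L - P2)], where [L] is [A] acting
    on the value and [P1], [P2] are [A] acting on the two arguments
    ([torsion_bracket_defect]).  The arguments live in [D] and the values in the
    image of [P], that is, in the sum of the other generalized eigenspaces;
    therefore [L] has no eigenvalue in common with [P1] or [P2], and both factors
    are injective ([spectral_intertwiner_eq0], [iter_torsion_step_inj]).  Hence
    the defect vanishes and [D] is involutive.  Since the hypothesis on the
    torsion speaks of global vector fields, local sections are multiplied by bump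
    functions and extended by zero ([vector_field_of_chart]).

    To pass from involutivity to integral manifolds one needs [D] to be smooth.
    The multiplicities are locally constant, so each eigenvalue is a simple root
    of a derivative of the characteristic polynomial; being continuous by
    hypothesis, it is smooth by the easy half of the implicit function theorem
    ([Ck_on_eigenvalue]).  Hence [D] has a smooth frame [sigma], which is
    normalized by [sigma pi = 1] for a fixed linear map [pi]; involutivity then
    makes the fields [h sigma], for constant rows [h], commute.

    Here the constancy of the ranks ensures that the frame spans [D].

    Finally the integral manifold through a point is the graph-like solution of
    the total differential equation [dg = sigma (g)].  It is constructed along
    the rays [s |-> s t] by Picard iteration, and its differentiability across
    the rays follows from the commutation of the fields [h sigma] by an estimate
    of Gronwall type ([frobenius_parametrization]); its smoothness is then read
    off from the equation. *)

Local Notation coord := Defs.coord.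

(** * Calculus of functions of class C^k *)

Section Calculus.
Context {R : realType}.
Implicit Types V W : normedModType R.

Lemma near_eq_differentiable V W (f g : V -> W) (x : V) :
  (\near x, f x = g x) -> differentiable f x -> differentiable g x.
Proof.
move=> fg df.
have fgx : f x = g x := nbhs_singleton fg.
have D : g \o shift x = cst (g x) + 'd f x +o_ 0 id.
  rewrite -fgx; apply/eqaddoP => _/posnumP[e].
  have /diff_locally /eqaddoP/(_ e%:num) := df.
  move=> /(_ [gt0 of e%:num]) H.
  have fg' : \forall h \near (0 : V), f (h + x) = g (h + x).
    move: fg; rewrite (near_shift 0 x) /= => fg; apply: filterS fg => h /=.
    by rewrite subr0.
  near=> h.
  have := near H h; rewrite /= => Hh.
  rewrite /= !fctE /= -(near fg' h) //.
  exact: Hh.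
have cdf := diff_continuous df.
have E := diff_unique cdf D.
by apply/diff_locallyP; rewrite E.
Unshelve. all: by end_near. Qed.

Lemma near_eq_continuous_at (T : topologicalType) W (f g : T -> W) (x : T) :
  (\near x, f x = g x) -> {for x, continuous f} -> {for x, continuous g}.
Proof.
move=> fg cf; rewrite /prop_for /continuous_at -(nbhs_singleton fg).
exact: (cvg_trans (near_eq_cvg fg)).
Qed.

Lemma eq_Ck_on k V W (U : set V) (f g : V -> W) :
  open U -> (forall x, U x -> f x = g x) -> Ck_on k U f -> Ck_on k U g.
Proof.
move=> oU; elim: k f g => [|k IH] f g fg /=.
  move=> cf x Ux; apply: near_eq_continuous_at (cf x Ux).
  by apply: filterS (open_nbhs_nbhs (conj oU Ux)) => y; exact: fg.
have near_fg x : U x -> \near x, f x = g x.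
  by move=> Ux; apply: filterS (open_nbhs_nbhs (conj oU Ux)) => y; exact: fg.
move=> [df Df]; split=> [x Ux|v];
  first exact: near_eq_differentiable (near_fg _ Ux) (df _ Ux).
by apply: IH (Df v) => x Ux; apply: near_eq_derive; exact: near_fg.
Qed.

Lemma Ck_on_subset k V W (U U' : set V) (f : V -> W) :
  U' `<=` U -> Ck_on k U f -> Ck_on k U' f.
Proof.
move=> sU; elim: k f => [|k IH] f /=; first by move=> cf x /sU; exact: cf.
by move=> [df Df]; split=> [x /sU/df//|v]; exact: IH.
Qed.

Lemma Ck_onW k V W (U : set V) (f : V -> W) : Ck_on k.+1 U f -> Ck_on k U f.
Proof.
elim: k f => [|k IH] f; first by move=> [df _] x Ux;
  exact: differentiable_continuous (df x Ux).
by move=> [df Df]; split=> // v; exact: IH.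
Qed.

(** Being of class C^k is a pointwise condition: the derivatives that it speaks
    of are taken in the whole space. *)
Lemma Ck_on_pointwise k V W (U : set V) (f : V -> W) :
  (forall x, U x -> exists2 U', U' x & Ck_on k U' f) -> Ck_on k U f.
Proof.
elim: k f => [|k IH] f H /=.
  by move=> x /H[U' U'x]; apply.
split=> [x /H[U' U'x [df _]]|v]; first exact: df.
by apply: IH => x /H[U' U'x [_ Df]]; exists U' => //; exact: Df.
Qed.

(** For functions defined by cases, such as an extension by zero: each point is
    treated with whichever formula is valid around it. *)
Lemma Ck_on_local k V W (U : set V) (f : V -> W) :
  (forall x, U x -> exists (U' : set V) (g : V -> W),
     [/\ open U', U' x, Ck_on k U' g & forall y, U' y -> g y = f y]) ->
  Ck_on k U f.
Proof.
move=> H; apply: Ck_on_pointwise => x /H[U' [g [oU' U'x Cg gf]]].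
by exists U' => //; exact: eq_Ck_on Cg.
Qed.

Lemma Ck_on_cst k V W (U : set V) (c : W) : Ck_on k U (fun _ : V => c).
Proof.
elim: k c => [|k IH] c /=; first by move=> x _; exact: cst_continuous.
split=> [x _|v]; first exact: differentiable_cst.
suff -> : (fun x => 'D_v (fun _ : V => c) x) = fun=> 0 by [].
by apply/funext => x; exact: derive_cst.
Qed.

Section Operations.
Variables (V : normedModType R) (U : set V).
Hypothesis oU : open U.

Lemma Ck_onD k W (f g : V -> W) : Ck_on k U f -> Ck_on k U g ->
  Ck_on k U (fun x => f x + g x).
Proof.
elim: k f g => [|k IH] f g /=.
  by move=> cf cg x Ux; apply: continuousD; [exact: cf|exact: cg].
move=> [df Df] [dg Dg]; split=> [x Ux|v].
  by apply: differentiableD; [exact: df|exact: dg].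
apply: eq_Ck_on (IH _ _ (Df v) (Dg v)) => // x Ux.
by rewrite deriveD //; apply: diff_derivable; [exact: df|exact: dg].
Qed.

Lemma Ck_onN k W (f : V -> W) : Ck_on k U f -> Ck_on k U (fun x => - f x).
Proof.
elim: k f => [|k IH] f /=; first by move=> cf x Ux; apply: continuousN; exact: cf.
move=> [df Df]; split=> [x Ux|v]; first by apply: differentiableN; exact: df.
apply: eq_Ck_on (IH _ (Df v)) => // x Ux.
by rewrite deriveN //; apply: diff_derivable; exact: df.
Qed.

Lemma Ck_onM k (f g : V -> R) : Ck_on k U f -> Ck_on k U g ->
  Ck_on k U (fun x => f x * g x).
Proof.
elim: k f g => [|k IH] f g.
  by move=> cf cg x Ux; apply: continuousM; [exact: cf|exact: cg].
move=> Cf Cg; have [df Df] := Cf; have [dg Dg] := Cg; split=> [x Ux|v].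
  by apply: differentiableM; [exact: df|exact: dg].
have := Ck_onD (IH _ _ (Ck_onW Cf) (Dg v)) (IH _ _ (Ck_onW Cg) (Df v)).
apply: eq_Ck_on => // x Ux.
by rewrite deriveM //; apply: diff_derivable; [exact: df|exact: dg].
Qed.

Lemma Ck_onV k (f : V -> R) : (forall x, U x -> f x != 0) ->
  Ck_on k U f -> Ck_on k U (fun x => (f x)^-1).
Proof.
move=> f0; elim: k => [|k IH].
  by move=> cf x Ux; apply: continuousV; [exact: f0|exact: cf].
move=> Cf; have [df Df] := Cf; split=> [x Ux|v].
  by apply: differentiableV; [exact: df|exact: f0].
have CV := IH (Ck_onW Cf).
have := Ck_onM (Ck_onM CV CV) (Ck_onN (Df v)).
apply: eq_Ck_on => // x Ux.
rewrite deriveV; [|exact: f0|by apply: diff_derivable; exact: df].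
by rewrite /GRing.scale /= mulrN mulNr expr2 invfM.
Qed.

Lemma Ck_on_sum k W (I : Type) (r : seq I) (P : pred I) (f : I -> V -> W) :
  (forall i, P i -> Ck_on k U (f i)) ->
  Ck_on k U (fun x => \sum_(i <- r | P i) f i x).
Proof.
move=> Cf; elim: r => [|i r IH].
  by apply: eq_Ck_on (Ck_on_cst k U 0) => // x _; rewrite big_nil.
case Pi: (P i); last by apply: eq_Ck_on IH => // x _; rewrite big_cons Pi.
by apply: eq_Ck_on (Ck_onD (Cf i Pi) IH) => // x _; rewrite big_cons Pi.
Qed.

Lemma Ck_on_prod k (I : Type) (r : seq I) (P : pred I) (f : I -> V -> R) :
  (forall i, P i -> Ck_on k U (f i)) ->
  Ck_on k U (fun x => \prod_(i <- r | P i) f i x).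
Proof.
move=> Cf; elim: r => [|i r IH].
  by apply: eq_Ck_on (Ck_on_cst k U (1 : R)) => // x _; rewrite big_nil.
case Pi: (P i); last by apply: eq_Ck_on IH => // x _; rewrite big_cons Pi.
by apply: eq_Ck_on (Ck_onM (Cf i Pi) IH) => // x _; rewrite big_cons Pi.
Qed.

Lemma differentiable_mx_entry p q (f : V -> 'M[R]_(p, q)) x i j :
  differentiable f x -> differentiable (fun y => f y i j) x.
Proof.
move=> df; apply: (@differentiable_comp _ _ _ _ f (fun N : 'M[R]_(p, q) => N i j)) => //.
exact: differentiable_coord.
Qed.

Lemma derive_mx_entry p q (f : V -> 'M[R]_(p, q)) x v i j :
  differentiable f x -> 'D_v f x i j = 'D_v (fun y => f y i j) x.
Proof. by move=> df; rewrite derive_mx ?mxE //; exact: diff_derivable. Qed.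

Lemma differentiable_mxP p q (f : V -> 'M[R]_(p, q)) x :
  differentiable f x <-> forall i j, differentiable (fun y => f y i j) x.
Proof.
split=> [df i j|df]; first exact: differentiable_mx_entry.
have -> : f = \sum_i \sum_j (fun y => f y i j *: delta_mx i j).
  apply/funext => y; rewrite [LHS]matrix_sum_delta fct_sumE; apply: eq_bigr => i _.
  by rewrite fct_sumE.
apply: differentiable_sum => i; apply: differentiable_sum => j.
exact: differentiableZl.
Qed.

Lemma Ck_on_mxP k p q (f : V -> 'M[R]_(p, q)) :
  Ck_on k U f <-> forall i j, Ck_on k U (fun x => f x i j).
Proof.
elim: k f => [|k IH] f.
  split=> [cf i j x Ux|cf x Ux].
    apply: (@continuous_comp _ _ _ f (fun N : 'M[R]_(p, q) => N i j)); first exact: cf.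
    exact: coord_continuous.
  apply/cvgrPdist_le => /= e e0; near=> y.
  rewrite /Num.Def.normr/= mx_normrE (bigmax_le _ (ltW e0))//= => i _.
  rewrite !mxE/=; move: i; near: y; apply: filter_forall => /= i.
  by have /cvgrPdist_le/(_ _ e0) := cf i.1 i.2 x Ux.
split=> [[df Df] i j|Cf].
  split=> [x Ux|v]; first by apply: differentiable_mx_entry; exact: df.
  have /IH/(_ i j) := Df v; apply: eq_Ck_on => // x Ux.
  by rewrite derive_mx_entry //; exact: df.
have df x : U x -> differentiable f x.
  by move=> Ux; apply/differentiable_mxP => i j; exact: (Cf i j).1.
split=> // v; apply/IH => i j; apply: eq_Ck_on ((Cf i j).2 v) => // x Ux.
by rewrite derive_mx_entry //; exact: df.
Unshelve. all: by end_near. Qed.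

Lemma Ck_on_mulmx k p q r (f : V -> 'M[R]_(p, q)) (g : V -> 'M[R]_(q, r)) :
  Ck_on k U f -> Ck_on k U g -> Ck_on k U (fun x => f x *m g x).
Proof.
move=> /Ck_on_mxP Cf /Ck_on_mxP Cg; apply/Ck_on_mxP => i j.
have := @Ck_on_sum k R _ (index_enum _) xpredT _ (fun l _ => Ck_onM (Cf i l) (Cg l j)).
by apply: eq_Ck_on => // x _; rewrite mxE.
Qed.

Lemma Ck_on_scalemx k p q (f : V -> R) (g : V -> 'M[R]_(p, q)) :
  Ck_on k U f -> Ck_on k U g -> Ck_on k U (fun x => f x *: g x).
Proof.
move=> Cf /Ck_on_mxP Cg; apply/Ck_on_mxP => i j.
by apply: eq_Ck_on (Ck_onM Cf (Cg i j)) => // x _; rewrite mxE.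
Qed.

Lemma Ck_on_scalar_mx k p (f : V -> R) :
  Ck_on k U f -> Ck_on k U (fun x => (f x)%:M : 'M[R]_p).
Proof.
move=> Cf; apply: eq_Ck_on (Ck_on_scalemx Cf (Ck_on_cst k U (1%:M : 'M[R]_p))) => // x _.
by rewrite scalemx1.
Qed.

Lemma Ck_on_det k p (f : V -> 'M[R]_p) :
  Ck_on k U f -> Ck_on k U (fun x => \det (f x)).
Proof.
move=> /Ck_on_mxP Cf.
apply: Ck_on_sum => s _; apply: Ck_onM; first exact: Ck_on_cst.
by apply: Ck_on_prod => i _; exact: Cf.
Qed.

Lemma Ck_on_invmx k p (f : V -> 'M[R]_p) : (forall x, U x -> f x \in unitmx) ->
  Ck_on k U f -> Ck_on k U (fun x => invmx (f x)).
Proof.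
move=> uf Cf.
have Cadj : Ck_on k U (fun x => \adj (f x)).
  apply/Ck_on_mxP => i j.
  suff : Ck_on k U (fun x => cofactor (f x) j i).
    by apply: eq_Ck_on => // x _; rewrite mxE.
  apply: Ck_onM; first exact: Ck_on_cst.
  apply: Ck_on_det; apply/Ck_on_mxP => a b; move/Ck_on_mxP: Cf => Cf.
  by apply: eq_Ck_on (Cf (lift j a) (lift i b)) => // x _; rewrite !mxE.
have Cdet : Ck_on k U (fun x => (\det (f x))^-1).
  apply: Ck_onV; last exact: Ck_on_det.
  by move=> x /uf; rewrite unitmxE unitfE.
apply: eq_Ck_on (Ck_on_scalemx Cdet Cadj) => // x Ux.
by rewrite /invmx uf.
Qed.

(** Chain rule in coordinates; the induction on the class works because the
    partial derivatives of the outer function are again composed with the same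
    inner function. *)
Lemma Ck_on_comp k n (U' : set 'rV[R]_n) (f : V -> 'rV[R]_n) (g : 'rV[R]_n -> R) :
  (forall x, U x -> U' (f x)) -> Ck_on k U f -> Ck_on k U' g ->
  Ck_on k U (fun x => g (f x)).
Proof.
move=> fU; elim: k g => [|k IH] g.
  by move=> cf cg x Ux; apply: continuous_comp; [exact: cf|apply: cg; exact: fU].
move=> Cf [dg Dg]; have [df Df] := Cf; split=> [x Ux|v].
  by apply: differentiable_comp; [exact: df|apply: dg; exact: fU].
have Cg i := IH _ (Ck_onW Cf) (Dg (delta_mx 0 i)).
have CDf i : Ck_on k U (fun x => 'D_v f x 0 i) by exact: (Ck_on_mxP _ _).1 (Df v) _ _.
have := @Ck_on_sum k R _ (index_enum _) xpredT _ (fun i _ => Ck_onM (CDf i) (Cg i)).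
apply: eq_Ck_on => // x Ux.
have dgx := dg _ (fU _ Ux); have dfx := df _ Ux.
rewrite [RHS]deriveE; last exact: differentiable_comp.
rewrite (diff_comp dfx dgx) /= -(deriveE v dfx).
rewrite [in RHS](row_sum_delta ('D_v f x)) linear_sum.
by apply: eq_bigr => i _; rewrite linearZ /= -deriveE.
Qed.

End Operations.

Lemma Ck_on_comp_mx k V (U : set V) n p q (U' : set 'rV[R]_n) (f : V -> 'rV[R]_n)
    (g : 'rV[R]_n -> 'M[R]_(p, q)) : open U -> open U' ->
  (forall x, U x -> U' (f x)) -> Ck_on k U f -> Ck_on k U' g ->
  Ck_on k U (fun x => g (f x)).
Proof.
move=> oU oU' fU Cf /(Ck_on_mxP oU') Cg; apply/(Ck_on_mxP oU) => i j.
exact: (Ck_on_comp oU fU Cf (Cg i j)).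
Qed.

End Calculus.

(** * Bump functions *)

Section Bump.
Context {R : realType}.

Lemma derive_scale (f : R -> R) (x v : R) :
  differentiable f x -> 'D_v f x = v * 'D_1 f x.
Proof. by move=> df; rewrite !deriveE // -[v in LHS]mulr1 linearZ. Qed.

Lemma Ck_on_comp1 k (V : normedModType R) (U : set V) (f : V -> R) (h : R -> R) :
  open U -> Ck_on k U f -> Ck_on k setT h -> Ck_on k U (fun x => h (f x)).
Proof.
move=> oU; elim: k h => [|k IH] h.
  by move=> cf ch x Ux; apply: continuous_comp; [exact: cf|exact: ch].
move=> Cf [dh Dh]; have [df Df] := Cf; split=> [x Ux|v].
  by apply: differentiable_comp; [exact: df|exact: dh].
apply: eq_Ck_on (Ck_onM oU (Df v) (IH _ (Ck_onW Cf) (Dh 1))) => // x Ux.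
have dfx := df x Ux; have dhx := dh (f x) I.
rewrite [RHS]deriveE; last exact: differentiable_comp.
by rewrite (diff_comp dfx dhx) /= -!deriveE // [RHS]derive_scale.
Qed.

(** The classical flat function and the functions that its derivatives are
    combinations of: [t^-j * exp (- t^-1)], extended by 0 to the left of 0. *)
Definition flat (j : nat) (t : R) : R :=
  if 0 < t then t^-1 ^+ j * expR (- t^-1) else 0.

Lemma flat_gt0 t : 0 < t -> 0 < flat 0 t.
Proof. by move=> t0; rewrite /flat t0 expr0 mul1r expR_gt0. Qed.

Lemma flat_le0 j t : t <= 0 -> flat j t = 0.
Proof. by rewrite /flat ltNge => ->. Qed.

Lemma flat_ge0 j t : 0 <= flat j t.
Proof.
rewrite /flat; case: ifP => // t0.
by rewrite mulr_ge0 ?expR_ge0 // exprn_ge0 // invr_ge0 ltW.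
Qed.

(** Since [expR u] dominates [(u / q) ^+ q] for every [q], here with [u = t^-1]
    and [q = j.+2].  A quadratic bound is what makes [flat j] differentiable at 0. *)
Lemma flat_le_sqr j t : flat j t <= (j.+2%:R ^+ j.+2) * t ^+ 2.
Proof.
rewrite /flat; case: ifP => t0; last by rewrite mulr_ge0 ?sqr_ge0 // exprn_ge0.
have t0' : t != 0 by rewrite gt_eqF.
set u := t^-1; have u0 : 0 < u by rewrite invr_gt0.
have m0 : 0 < (j.+2%:R : R) by [].
have H : (u / j.+2%:R) ^+ j.+2 <= expR u.
  rewrite -{2}(@divfK _ j.+2%:R _ u) ?gt_eqF // [_ * j.+2%:R]mulrC expRM_natl.
  rewrite lerXn2r ?nnegrE ?divr_ge0 ?expR_ge0 ?ltW //.
  by apply: le_lt_trans (expR_gt1Dx _); rewrite ?lerDr ?gt_eqF ?divr_gt0.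
rewrite expRN ler_pdivrMr ?expR_gt0 //.
have -> : t = u^-1 by rewrite /u invrK.
apply: le_trans (_ : j.+2%:R ^+ j.+2 * u^-1 ^+ 2 * (u / j.+2%:R) ^+ j.+2 <= _).
  rewrite exprMn exprVn [X in _ <= X](_ : _ = u ^+ j) //.
  rewrite -[in u ^+ j.+2]addn2 exprD !exprVn.
  by field; rewrite ?gt_eqF ?exprn_gt0.
by rewrite ler_pM2l // mulr_gt0 ?exprn_gt0 ?invr_gt0.
Qed.

(** The family [flat j] is closed under differentiation up to linear
    combinations, so that differentiability of all its members gives smoothness. *)
Lemma is_derive_flat j (t : R) :
  is_derive t 1 (flat j) (flat j.+2 t - j%:R * flat j.+1 t).
Proof.
have [t0|t0|<-] := ltgtP 0 t.
- have near_t : \near t, t^-1 ^+ j * expR (- t^-1) = flat j t.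
    near=> x; rewrite /flat ifT //; near: x; exact: lt_nbhsr.
  apply: near_eq_is_derive near_t _.
  have t0' : t != 0 by rewrite gt_eqF.
  have dV : is_derive t 1 (fun x : R => x^-1) (- t^-1 ^+ 2).
    have did : derivable (@id R) t 1 by exact: derivable_id.
    apply: DeriveDef; first exact: (@derivableV _ _ (@id R)).
    by rewrite (@deriveV _ _ (@id R)) // derive_id /GRing.scale /= mulr1 exprVn.
  have dE : is_derive t 1 (fun x : R => expR (- x^-1)) (t^-1 ^+ 2 * expR (- t^-1)).
    have d1 := is_deriveN dV.
    have := @is_derive1_comp R expR (fun x => - x^-1) t _ _ (is_derive_expR _) d1.
    by move=> d2; apply: is_derive_eq d2 _; rewrite opprK mulrC.
  have dX := is_deriveX j dV.
  rewrite (_ : (fun u => _) = (@GRing.inv R) ^+ j * (fun x => expR (- x^-1))).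
    apply: is_derive_eq (is_deriveM dX dE) _.
    rewrite /flat t0 /GRing.scale /= exprfctE.
    case: j {dX} => [|j] /=; first by rewrite !mul0r; ring.
    by rewrite !exprS; ring.
  by apply/funext => x; rewrite mulrfctE exprfctE.
- apply: (@near_eq_is_derive _ _ _ (cst 0)) (is_derive_eq (is_derive_cst _ _ _) _).
    near=> x; rewrite flat_le0 //; apply: ltW; near: x; exact: lt_nbhsl.
  by rewrite !flat_le0 ?(ltW t0) // mulr0 subr0.
- rewrite !flat_le0 // mulr0 subr0.
  set C : R := j.+2%:R ^+ j.+2.
  have C0 : 0 < C by rewrite exprn_gt0.
  suff H : h^-1 *: (flat j (h *: 1 + 0) - flat j 0) @[h --> 0^'] --> (0 : R).
    by apply: DeriveDef; [apply/cvg_ex; exists 0|exact/cvg_lim].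
  apply/cvgrPdist_le => e e0; near=> h.
  rewrite sub0r normrN (@flat_le0 j 0) // subr0 addr0 /GRing.scale /= mulr1.
  have h0 : h != 0 by near: h; exact: nbhs_dnbhs_neq.
  rewrite normrM normfV (ger0_norm (flat_ge0 _ _)).
  apply: le_trans (_ : `|h|^-1 * (C * h ^+ 2) <= _).
    by rewrite ler_wpM2l ?invr_ge0 // flat_le_sqr.
  rewrite -real_normK ?num_real // mulrCA expr2 mulKf ?normr_eq0 //.
  rewrite mulrC -ler_pdivlMr //; apply: ltW.
  by near: h; apply: dnbhs0_lt; exact: divr_gt0.
Unshelve. all: by end_near. Qed.

Lemma Ck_on_flat k j : Ck_on k setT (flat j).
Proof.
have df j' (x : R) : differentiable (flat j') x.
  by apply/derivable1_diffP; exact: (@ex_derive _ _ _ _ _ _ _ (is_derive_flat j' x)).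
elim: k j => [|k IH] j; first by move=> x _; exact: differentiable_continuous.
split=> // v.
have C1 := Ck_onM openT (Ck_on_cst k setT (j%:R : R)) (IH j.+1).
have := Ck_onM openT (Ck_on_cst k setT v) (Ck_onD openT (IH j.+2) (Ck_onN openT C1)).
apply: eq_Ck_on; first exact: openT.
by move=> x _; rewrite derive_scale // (@derive_val _ _ _ _ _ _ _ (is_derive_flat j x)).
Qed.

(** The factor of index [j] is positive exactly when [x 0 j] is at distance less
    than [r] from [p 0 j]; the product is therefore positive exactly on the ball of
    the maximum norm. *)
Definition bump_fun n (p : 'rV[R]_n) (r : R) (x : 'rV[R]_n) : R :=
  \prod_j (flat 0 (r - (x 0 j - p 0 j)) * flat 0 (r + (x 0 j - p 0 j))).

Lemma Ck_on_bump_fun k n (p : 'rV[R]_n) r : Ck_on k setT (bump_fun p r).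
Proof.
apply: (Ck_on_prod openT) => j _.
have Cj : Ck_on k setT (fun x : 'rV[R]_n => x 0 j).
  have cid : Ck_on k setT (@id 'rV[R]_n).
    case: k => [|k]; first by move=> x _; exact: cvg_id.
    split=> [x _|v]; first exact: (@ex_diff _ _ _ _ _ _ _ (is_diff_id x)).
    apply: eq_Ck_on (Ck_on_cst k setT v) => [|x _]; first exact: openT.
    by rewrite derive_id.
  exact: (Ck_on_mxP openT _ _).1 cid 0 j.
have Cd := Ck_onD openT Cj (Ck_on_cst k setT (- p 0 j)).
have Cr := Ck_on_cst k (setT : set 'rV[R]_n) r.
apply: (Ck_onM openT); apply: (Ck_on_comp1 openT) (Ck_on_flat _ _).
  exact: (Ck_onD openT Cr (Ck_onN openT Cd)).
exact: (Ck_onD openT Cr Cd).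
Qed.

Lemma bump_fun_gt0 n (p : 'rV[R]_n) r : 0 < r -> 0 < bump_fun p r p.
Proof.
move=> r0; apply: prodr_gt0 => j _.
by rewrite subrr subr0 addr0 mulr_gt0 ?flat_gt0.
Qed.

Lemma bump_fun_eq0 n (p : 'rV[R]_n) r x : 0 < r -> r <= `|x - p| -> bump_fun p r x = 0.
Proof.
move=> r0 rx.
suff [j rj] : exists j, r <= `|x 0 j - p 0 j|.
  apply/eqP/prodf_eq0; exists j => //; rewrite mulf_eq0.
  move: rj; rewrite ler_normr => /orP[h|h].
    by rewrite [flat 0 (r - _)]flat_le0 ?eqxx // subr_le0.
  rewrite [flat 0 (r + (x 0 j - _))]flat_le0 ?eqxx ?orbT //.
  by rewrite -[x 0 j - _]opprK subr_le0.
move: rx; rewrite /Num.Def.normr/= => rx.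
have [|[i j] E] := @mx_norm_neq0 R 1 n (x - p).
  by apply: contraTneq rx => ->; rewrite -ltNge.
by exists j; move: rx; rewrite E /= !mxE ord1.
Qed.

End Bump.

(** * Mean value estimates, primitives and ordinary differential equations *)

Section MeanValue.
Context {R : realType}.

Lemma mx_norm_le p q (x : 'M[R]_(p, q)) (C : R) :
  0 <= C -> (forall i j, `|x i j| <= C) -> `|x| <= C.
Proof.
by move=> C0 xC; rewrite /Num.Def.normr/= mx_normrE; apply: bigmax_le => // i _.
Qed.

Lemma entry_le_mx_norm p q (x : 'M[R]_(p, q)) i j : `|x i j| <= `|x|.
Proof.
rewrite [X in _ <= X]/Num.Def.normr/= mx_normrE.
exact: (le_bigmax _ (fun ij : 'I_p * 'I_q => `|x ij.1 ij.2|) (i, j)).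
Qed.

Lemma norm_mulmx_le r p q (h : 'M[R]_(p, r)) (B : 'M[R]_(r, q)) :
  `|h *m B| <= r%:R * (`|h| * `|B|).
Proof.
apply: mx_norm_le => [|i j]; first by rewrite mulr_ge0 // mulr_ge0.
rewrite mxE; apply: le_trans (ler_norm_sum _ _ _) _.
apply: le_trans (_ : \sum_(l < r) `|h| * `|B| <= _).
  by apply: ler_sum => l _; rewrite normrM ler_pM // entry_le_mx_norm.
by rewrite sumr_const card_ord mulr_natl.
Qed.

Lemma is_derive_entry (V : normedModType R) p q (f : V -> 'M[R]_(p, q)) (s v : V) df i j :
  is_derive s v f df -> is_derive s v (fun x => f x i j) (df i j).
Proof.
move=> [dfs <-]; apply: DeriveDef; first exact: (derivable_mxP _ _ _).1 dfs i j.
by rewrite derive_mx // mxE.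
Qed.

Lemma is_derive_mxP (V : normedModType R) p q (f : V -> 'M[R]_(p, q)) (s v : V)
    (df : 'M[R]_(p, q)) :
  (forall i j, is_derive s v (fun x => f x i j) (df i j)) -> is_derive s v f df.
Proof.
move=> H.
have dfs : derivable f s v.
  by apply/derivable_mxP => i j; exact: (@ex_derive _ _ _ _ _ _ _ (H i j)).
apply: DeriveDef => //; apply/matrixP => i j.
by rewrite derive_mx // mxE (@derive_val _ _ _ _ _ _ _ (H i j)).
Qed.

Lemma is_derive_mulmx (V : normedModType R) p q r (f : V -> 'M[R]_(p, q))
    (g : V -> 'M[R]_(q, r)) (x v : V) df dg :
  is_derive x v f df -> is_derive x v g dg ->
  is_derive x v (fun y => f y *m g y) (df *m g x + f x *m dg).
Proof.
move=> dfx dgx; apply: is_derive_mxP => i j.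
rewrite (_ : (fun y => _) = \sum_l ((fun y => f y i l) * (fun y => g y l j))); last first.
  by apply/funext => y; rewrite mxE fct_sumE.
apply: is_derive_eq (is_derive_sum (fun l => is_deriveM (is_derive_entry i l dfx)
  (is_derive_entry l j dgx))) _.
rewrite !mxE -big_split /=; apply: eq_bigr => l _.
by rewrite /GRing.scale /= addrC [g x l j * _]mulrC.
Qed.

Lemma derive_mulmx (V : normedModType R) p q r (f : V -> 'M[R]_(p, q))
    (g : V -> 'M[R]_(q, r)) (x v : V) :
  differentiable f x -> differentiable g x ->
  'D_v (fun y => f y *m g y) x = 'D_v f x *m g x + f x *m 'D_v g x.
Proof.
move=> df dg.
have dfx : is_derive x v f ('D_v f x) by apply: DeriveDef => //; exact: diff_derivable.
have dgx : is_derive x v g ('D_v g x) by apply: DeriveDef => //; exact: diff_derivable.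
exact: (@derive_val _ _ _ _ _ _ _ (is_derive_mulmx dfx dgx)).
Qed.

Lemma lipschitz_continuous (V W : normedModType R) (f : V -> W) (K : R) : 0 <= K ->
  (forall x y, `|f x - f y| <= K * `|x - y|) -> continuous f.
Proof.
move=> K0 Hf x; apply/cvgrPdist_le => e e0.
have K1 : 0 < K + 1 by rewrite ltr_wpDl.
near=> y.
apply: le_trans (Hf _ _) _.
apply: le_trans (_ : (K + 1) * `|x - y| <= _); first by rewrite ler_wpM2r // lerDl.
rewrite mulrC -ler_pdivlMr //; apply: ltW.
near: y; apply: (@cvgr_dist_lt _ _ _ (nbhs x) _ id); first exact: cvg_id.
exact: divr_gt0.
Unshelve. all: by end_near. Qed.

Lemma mulmxr_continuous p q r (B : 'M[R]_(q, r)) :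
  continuous (fun x : 'M[R]_(p, q) => x *m B).
Proof.
apply: (@lipschitz_continuous _ _ _ (q%:R * `|B|)) => [|x y]; first exact: mulr_ge0.
rewrite -mulmxBl; apply: le_trans (norm_mulmx_le _ _) _.
by rewrite mulrCA [`|x - y| * _]mulrC.
Qed.

Lemma is_derive_continuous (V : normedModType R) (f : R -> V) (s : R) (df : V) :
  is_derive s 1 f df -> {for s, continuous f}.
Proof.
by move=> dfs; apply/differentiable_continuous/derivable1_diffP; exact: ex_derive.
Qed.

Lemma is_derive_curve (V W : normedModType R) (c : R -> V) (f : V -> W) (s : R) (dc : V) :
  is_derive s 1 c dc -> differentiable f (c s) ->
  is_derive s 1 (fun x => f (c x)) ('d f (c s) dc).
Proof.
move=> [dcs <-] df.
have dc' : differentiable c s by apply/derivable1_diffP.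
have dfc := differentiable_comp dc' df.
apply: DeriveDef; first exact: diff_derivable.
by rewrite (deriveE _ dfc) (diff_comp dc' df) /= (deriveE _ dc').
Qed.

Lemma is_derive_comp_curve (W : normedModType R) (c : R -> R) (F : R -> W) (s dc : R)
  (dF : W) :
  is_derive s 1 c dc -> is_derive (c s) 1 F dF ->
  is_derive s 1 (fun x => F (c x)) (dc *: dF).
Proof.
move=> dcs dFs.
have dF' : differentiable F (c s) by apply/derivable1_diffP; exact: ex_derive.
apply: is_derive_eq (is_derive_curve dcs dF') _.
rewrite -[dc in LHS]mulr1 linearZ -deriveE //.
by rewrite (@derive_val _ _ _ _ _ _ _ dFs).
Qed.

Lemma mean_value_le p q (f df : R -> 'M[R]_(p, q)) (b C : R) : 0 <= b ->
  (forall s : R, 0 <= s <= b -> is_derive s 1 f (df s)) ->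
  (forall s : R, 0 <= s <= b -> `|df s| <= C) -> `|f b - f 0| <= C * b.
Proof.
move=> b0 dfs Cdf.
have C0 : 0 <= C by apply: le_trans (Cdf 0 _); rewrite ?lexx ?b0.
apply: mx_norm_le => [|i j]; first exact: mulr_ge0.
have dij s : 0 <= s <= b -> is_derive s 1 (fun x => f x i j) (df s i j).
  by move=> /dfs; exact: is_derive_entry.
have [||c] := @MVT_segment R (fun x => f x i j) (fun x => df x i j) 0 b b0.
- by move=> x; rewrite in_itv /= => /andP[x0 xb]; apply: dij; rewrite !ltW.
- apply: derivable_within_continuous => x; rewrite in_itv /= => xb.
  exact: (@ex_derive _ _ _ _ _ _ _ (dij x xb)).
rewrite in_itv /= subr0 => cb E.
rewrite !mxE E normrM (ger0_norm b0) ler_wpM2r //.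
exact: le_trans (entry_le_mx_norm _ _ _) (Cdf _ cb).
Qed.

(** A substitute for Gronwall's inequality on the unit interval: with a constant
    at most 1/2 the maximum of [`|d|] can be absorbed. *)
Lemma absorb_derive p q (d dd : R -> 'M[R]_(p, q)) (a c : R) :
  0 <= a <= 2^-1 -> 0 <= c -> d 0 = 0 ->
  (forall s : R, 0 <= s <= 1 -> is_derive s 1 d (dd s)) ->
  (forall s : R, 0 <= s <= 1 -> `|dd s| <= a * `|d s| + c) ->
  forall s : R, 0 <= s <= 1 -> `|d s| <= 2 * c.
Proof.
move=> /andP[a0 a2] c0 d0 ds ddc.
have cd : {within `[0, 1], continuous (fun s => `|d s|)}.
  apply: continuous_in_subspaceT => x; rewrite inE /= in_itv /= => x01.
  by apply: continuous_comp;
    [exact: is_derive_continuous (ds x x01)|exact: norm_continuous].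
have [m] := EVT_max ler01 cd; rewrite in_itv /= => m01 max_m.
have /andP[m0 m1] := m01.
have dm : `|d m| <= 2 * c.
  have H : `|d m - d 0| <= (a * `|d m| + c) * m.
    apply: mean_value_le => // s /andP[s0 sm].
      by apply: ds; rewrite s0 (le_trans sm).
    have s01 : 0 <= s <= 1 by rewrite s0 (le_trans sm).
    apply: le_trans (ddc _ s01) _; rewrite lerD2r ler_wpM2l //.
    by apply: max_m; rewrite in_itv.
  rewrite d0 subr0 in H.
  have n0 : 0 <= `|d m| by [].
  have an0 := mulr_ge0 a0 n0.
  have H1 : (a * `|d m| + c) * m <= a * `|d m| + c by rewrite ler_piMr // addr_ge0.
  have H2 : a * `|d m| <= 2^-1 * `|d m| by rewrite ler_wpM2r.
  lra.
by move=> s s01; apply: le_trans dm; apply: max_m; rewrite in_itv.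
Qed.

Lemma primitive_exists (f : R -> R) : continuous f ->
  exists F : R -> R, F 0 = 0 /\ forall s : R, 0 <= s <= 1 -> is_derive s 1 F (f s).
Proof.
move=> cf; pose F (x : R) : R := (\int[lebesgue_measure]_(t in `[(-1), x]) f t)%R.
exists (fun x => F x - F 0); split=> [|s /andP[s0 s1]]; first by rewrite subrr.
have s2 : s < 2 by lra.
have s1' : -1 < s by lra.
have If : (@lebesgue_measure R).-integrable `[(-1), 2] (EFin \o f).
  apply: continuous_compact_integrable; first exact: segment_compact.
  exact: continuous_subspaceT.
have [dF F'] := @continuous_FTC1_closed R f (-1) s 2 s2 If s1' (cf s).
have dF' : is_derive s 1 F (f s) by apply: DeriveDef => //; rewrite -derive1E.
apply: is_derive_eq (is_deriveB dF' (is_derive_cst (F 0) s 1)) _.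
by rewrite subr0.
Qed.

Lemma primitive_mx_exists p q (f : R -> 'M[R]_(p, q)) : continuous f ->
  exists F : R -> 'M[R]_(p, q),
    F 0 = 0 /\ forall s : R, 0 <= s <= 1 -> is_derive s 1 F (f s).
Proof.
move=> cf.
have H i j : exists F : R -> R,
    F 0 = 0 /\ forall s : R, 0 <= s <= 1 -> is_derive s 1 F (f s i j).
  apply: primitive_exists => s;
    apply: (@continuous_comp _ _ _ f (fun M : 'M[R]_(p, q) => M i j)).
    exact: cf.
  exact: coord_continuous.
pose F i j := projT1 (cid (H i j)).
have HF i j : F i j 0 = 0 /\ forall s : R, 0 <= s <= 1 -> is_derive s 1 (F i j) (f s i j).
  exact: projT2 (cid (H i j)).
exists (fun s => \matrix_(i, j) F i j s); split.
  by apply/matrixP => i j; rewrite !mxE (HF i j).1.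
move=> s s01; apply: is_derive_mxP => i j.
have -> : (fun x => (\matrix_(i0, j0) F i0 j0 x) i j) = F i j.
  by apply/funext => x; rewrite mxE.
exact: (HF i j).2.
Qed.

End MeanValue.

Section GeometricLimit.
Context {R : realType}.

Lemma le_of_geometric (a b K : R) :
  (forall k, a <= b + K / 2 ^+ k) -> a <= b.
Proof.
move=> H; apply/ler_addgt0Pr => e e0.
have [K0|K0] := leP K 0.
  apply: le_trans (H 0) _; rewrite lerD2l expr0 divr1.
  exact: le_trans K0 (ltW e0).
have [k Hk] : exists k, K / e < 2 ^+ k.
  exists (Num.bound (K / e)); apply: lt_trans (archi_boundP _) _.
    by rewrite divr_ge0 ?ltW.
  by rewrite -natrX ltr_nat ltn_expl.
apply: le_trans (H k) _; rewrite lerD2l ler_pdivrMr ?exprn_gt0 //.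
by rewrite mulrC -ler_pdivrMr // ltW.
Qed.

(** The limit of a sequence with geometrically decreasing steps is obtained
    from the order completeness of the real numbers: [u k - 2 * C / 2 ^+ k]
    increases and [u k + 2 * C / 2 ^+ k] decreases. *)
Lemma geometric_limit_real (u : nat -> R) (C : R) :
  (forall k, `|u k.+1 - u k| <= C / 2 ^+ k) ->
  exists l, forall k, `|u k - l| <= 2 * C / 2 ^+ k.
Proof.
move=> H; pose e k := C / 2 ^+ k.
have e_half k : e k.+1 = e k / 2.
  by rewrite /e exprS invfM mulrA mulrAC.
have C0 : 0 <= C by have := le_trans (normr_ge0 _) (H 0); rewrite expr0 divr1.
have e0 k : 0 <= e k by rewrite divr_ge0 // exprn_ge0.
have step k : -(e k) <= u k.+1 - u k <= e k by rewrite -ler_norml H.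
pose a k := u k - 2 * e k; pose b k := u k + 2 * e k.
have amono : {homo a : i j / (i <= j)%N >-> i <= j}.
  apply: homo_leq => [x|y x z|k]; [exact: lexx|exact: le_trans|].
  by rewrite /a e_half; have := step k; lra.
have bmono : {homo b : i j / (i <= j)%N >-> j <= i}.
  apply: homo_leq => [x|y x z xy yz|k]; [exact: lexx|exact: le_trans yz xy|].
  by rewrite /b e_half; have := step k; lra.
have ab i j : a i <= b j.
  apply: le_trans (amono _ _ (leq_maxl i j)) _.
  apply: le_trans (bmono _ _ (leq_maxr i j)).
  by rewrite /a /b; have := e0 (maxn i j); lra.
have hs : has_sup (range a).
  by split; [exists (a 0), 0|exists (b 0) => _ [i _ <-]].
exists (sup (range a)) => k.
have l1 : a k <= sup (range a) by apply: sup_upper_bound => //; exists k.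
have l2 : sup (range a) <= b k by apply: sup_le_ub hs.1 _ => _ [i _ <-].
by rewrite ler_norml -mulrA -/(e k); move: l1 l2; rewrite /a /b; lra.
Qed.

Lemma geometric_limit p q (u : nat -> 'M[R]_(p, q)) (C : R) :
  (forall k, `|u k.+1 - u k| <= C / 2 ^+ k) ->
  exists l, forall k, `|u k - l| <= 2 * C / 2 ^+ k.
Proof.
move=> H.
have C0 : 0 <= C by have := le_trans (normr_ge0 _) (H 0); rewrite expr0 divr1.
have Hij i j : exists l, forall k, `|u k i j - l| <= 2 * C / 2 ^+ k.
  apply: geometric_limit_real => k; apply: le_trans (H k).
  by apply: le_trans (entry_le_mx_norm _ i j); rewrite !mxE.
exists (\matrix_(i, j) projT1 (cid (Hij i j))) => k.
apply: mx_norm_le => [|i j]; first by rewrite divr_ge0 ?exprn_ge0 // mulr_ge0.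
by rewrite !mxE; exact: (projT2 (cid (Hij i j))).
Qed.

End GeometricLimit.

Section Picard.
Context {R : realType}.
Variables (n : nat) (f : 'rV[R]_n -> 'rV[R]_n) (C : R) (z0 : 'rV[R]_n).
Hypothesis f_contracting : forall z w, `|f z - f w| <= 2^-1 * `|z - w|.
Hypothesis f_bounded : forall z, `|f z| <= C.

Let clamp01 (s : R) : R := if s <= 0 then 0 else if 1 <= s then 1 else s.

Let clamp01_bound s : 0 <= clamp01 s <= 1.
Proof.
by rewrite /clamp01; case: (leP s 0) => h; case: (leP 1 s) => h'; lra.
Qed.

Let clamp01_id s : 0 <= s <= 1 -> clamp01 s = s.
Proof. by rewrite /clamp01; case: (leP s 0) => h; case: (leP 1 s) => h'; lra. Qed.

Let clamp01_lip s t : `|clamp01 s - clamp01 t| <= `|s - t|.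
Proof.
rewrite ler_norml /clamp01; case: (leP s 0) => ?; case: (leP 1 s) => ?;
  case: (leP t 0) => ?; case: (leP 1 t) => ?; case: (lerP s t) => ?; lra.
Qed.

Let C_ge0 : 0 <= C. Proof. exact: le_trans (normr_ge0 (f 0)) (f_bounded 0). Qed.

Let lip (w : R -> 'rV[R]_n) := forall s t, `|w s - w t| <= C * `|s - t|.

Let lip_continuous w : lip w -> continuous (f \o w).
Proof.
move=> lw; apply: (lipschitz_continuous C_ge0) => s t.
apply: le_trans (f_contracting _ _) _; apply: le_trans (lw s t).
by rewrite ler_piMl // invf_le1 // ler1n.
Qed.

Let prim (g : R -> 'rV[R]_n) : R -> 'rV[R]_n :=
  xget (fun=> 0) [set F | F 0 = 0 /\ forall s : R, 0 <= s <= 1 -> is_derive s 1 F (g s)].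

Let primP w : lip w -> prim (f \o w) 0 = 0 /\
  forall s : R, 0 <= s <= 1 -> is_derive s 1 (prim (f \o w)) (f (w s)).
Proof.
move=> /lip_continuous /primitive_mx_exists [F HF].
by rewrite /prim; case: xgetP => [G _ //|/(_ F)].
Qed.

Let picard_step (w : R -> 'rV[R]_n) (s : R) := z0 + prim (f \o w) (clamp01 s).

Let is_derive_bound (F F' : R -> 'rV[R]_n) (K s t : R) :
  (forall s : R, 0 <= s <= 1 -> is_derive s 1 F (F' s)) ->
  (forall s : R, 0 <= s <= 1 -> `|F' s| <= K) -> 0 <= s <= 1 -> 0 <= t <= 1 ->
  `|F s - F t| <= K * `|s - t|.
Proof.
move=> dF F'K; wlog st : s t / t <= s.
  move=> W s01 t01; have [/W|/ltW/W] := leP t s; first exact.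
  by rewrite distrC [X in _ * X]distrC; exact.
move=> /andP[s0 s1] /andP[t0 t1].
have st0 : 0 <= s - t by rewrite subr_ge0.
have := @mean_value_le R 1 n (fun x => F (x + t)) (fun x => F' (x + t)) (s - t) K st0.
rewrite subrK add0r (ger0_norm st0); apply => x /andP[x0 xs].
  have xt : 0 <= x + t <= 1 by lra.
  have dsh : is_derive x 1 (fun y : R => y + t) 1.
    by apply: is_derive_eq (is_deriveD (is_derive_id x 1) (is_derive_cst t x 1)) _;
      rewrite addr0.
  by apply: is_derive_eq (is_derive_comp_curve dsh (dF _ xt)) _; rewrite scale1r.
by apply: F'K; lra.
Qed.

Let picard_step_lip w : lip w -> lip (picard_step w).
Proof.
move=> lw s t; rewrite /picard_step opprD addrACA subrr add0r.
apply: le_trans (_ : C * `|clamp01 s - clamp01 t| <= _); last first.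
  by rewrite ler_wpM2l // clamp01_lip.
by apply: is_derive_bound (primP lw).2 _ _ _.
Qed.

Let picard_iter k : R -> 'rV[R]_n := iter k picard_step (fun=> z0).

Let picard_iter_lip k : lip (picard_iter k).
Proof.
elim: k => [|k IH]; last exact: picard_step_lip.
by move=> s t; rewrite subrr normr0 mulr_ge0.
Qed.

Let picard_step_contracting v w K : lip v -> lip w -> (forall s, `|v s - w s| <= K) ->
  forall s, `|picard_step v s - picard_step w s| <= 2^-1 * K.
Proof.
move=> lv lw vw s; rewrite /picard_step opprD addrACA subrr add0r.
have [pv0 dpv] := primP lv; have [pw0 dpw] := primP lw.
have /andP[s0 s1] := clamp01_bound s.
have K0 : 0 <= K by exact: le_trans (normr_ge0 _) (vw 0).
have := @mean_value_le R 1 n (prim (f \o v) - prim (f \o w))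
  (fun s => f (v s) - f (w s)) (clamp01 s) (2^-1 * K) s0.
rewrite !fctE pv0 pw0 !subrr subr0 => H; apply: le_trans (H _ _) _.
- move=> x /andP[x0 xs].
  by apply: is_deriveB; [apply: dpv|apply: dpw]; rewrite x0 (le_trans xs).
- by move=> x _; apply: le_trans (f_contracting _ _) _; rewrite ler_wpM2l.
- by rewrite ler_piMr // mulr_ge0.
Qed.

(** Picard iteration for an autonomous equation on the unit interval, whose
    right-hand side contracts enough to be iterated on the whole interval.  The
    iterates are extended by constants outside the interval, so that the
    solution satisfies the equation with two-sided derivatives at the ends. *)
Lemma picard : exists z : R -> 'rV[R]_n,
  z 0 = z0 /\ forall s : R, 0 <= s <= 1 -> is_derive s 1 z (f (z s)).
Proof.
have stp k s : `|picard_iter k.+1 s - picard_iter k s| <= C / 2 ^+ k.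
  elim: k s => [|k IH] s.
    rewrite /picard_iter /= /picard_step addrC addKr expr0 divr1.
    have [p0 dp] := primP (picard_iter_lip 0).
    have /andP[s0 s1] := clamp01_bound s.
    have := @mean_value_le R 1 n (prim (f \o (fun=> z0))) (fun=> f z0) (clamp01 s) C s0.
    rewrite p0 subr0 => H; apply: le_trans (H _ _) _ => //.
      by move=> x /andP[x0 xs]; apply: dp; rewrite x0 (le_trans xs).
    by rewrite ler_piMr.
  have := picard_step_contracting (picard_iter_lip k.+1) (picard_iter_lip k) IH s.
  by rewrite exprS invfM mulrCA.
pose w s := projT1 (cid (geometric_limit (stp ^~ s))).
have wP k s : `|picard_iter k s - w s| <= 2 * C / 2 ^+ k.
  by rewrite /w; case: cid => l /=; apply.
have lw : lip w.
  move=> s t; apply: (@le_of_geometric _ _ _ (4 * C)) => k.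
  have -> : w s - w t = (picard_iter k s - picard_iter k t) +
      (- (picard_iter k s - w s) + (picard_iter k t - w t)).
    by apply/matrixP => i j; rewrite !mxE; ring.
  apply: le_trans (ler_normD _ _) (lerD (picard_iter_lip k s t) _).
  apply: le_trans (ler_normD _ _) _; rewrite normrN.
  by have := wP k s; have := wP k t; lra.
have [p0 dp] := primP lw.
have zw s : picard_step w s = w s.
  apply/eqP; rewrite -subr_eq0 -normr_le0.
  apply: (@le_of_geometric _ _ _ (2 * C)) => k; rewrite add0r.
  have -> : picard_step w s - w s = (picard_step w s - picard_iter k.+1 s) +
    (picard_iter k.+1 s - w s).
    by rewrite addrA subrK.
  apply: le_trans (ler_normD _ _) _.
  have H1 : `|picard_step w s - picard_iter k.+1 s| <= 2^-1 * (2 * C / 2 ^+ k).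
    by apply: picard_step_contracting => // t; rewrite distrC; exact: wP.
  have := wP k.+1 s; rewrite exprS invfM.
  move: H1; set e := (2 ^+ k)^-1; lra.
exists (fun s => z0 + prim (f \o w) s); split; first by rewrite p0 addr0.
move=> s s01.
have -> : z0 + prim (f \o w) s = w s by rewrite -zw /picard_step clamp01_id.
apply: is_derive_eq (is_deriveD (is_derive_cst z0 s 1) (dp s s01)) _.
by rewrite add0r.
Qed.

End Picard.

(** * Quantitative differentiability *)

Section LocalEstimates.
Context {R : realType}.

Lemma is_derive_line (V : normedModType R) (x v : V) (s : R) :
  is_derive s 1 (fun s : R => s *: v + x) v.
Proof.
have dv : differentiable (fun s : R => s *: v) s by exact: (@ex_diff _ _ _ _ _ _ _
  (is_diff_scalel s v)).
have Dv : is_derive s 1 (fun s : R => s *: v) v.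
  apply: DeriveDef; first exact: diff_derivable.
  by rewrite deriveE // (@diff_val _ _ _ _ _ _ _ (is_diff_scalel s v)) scale1r.
by apply: is_derive_eq (is_deriveD Dv (is_derive_cst x s 1)) _; rewrite addr0.
Qed.

Lemma nbhs_norm0_lt (V : normedModType R) (e : R) : 0 < e ->
  \forall h \near (0 : V), `|h| < e.
Proof. by move=> e0; exact: nbhs0_lt. Qed.

Lemma derive_row_sum n (W : normedModType R) (f : 'rV[R]_n -> W) (x v : 'rV[R]_n) :
  differentiable f x -> 'D_v f x = \sum_j v 0 j *: 'D_('e_j) f x.
Proof.
move=> df; rewrite deriveE // {1}(row_sum_delta v) linear_sum.
by apply: eq_bigr => j _; rewrite linearZ /= -deriveE.
Qed.

Lemma segment_ball n (x y x0 : 'rV[R]_n) (r s : R) : 0 <= s <= 1 ->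
  `|x - x0| <= r -> `|y - x0| <= r -> `|s *: (y - x) + x - x0| <= r.
Proof.
move=> /andP[s0 s1] xr yr.
have -> : s *: (y - x) + x - x0 = s *: (y - x0) + (1 - s) *: (x - x0).
  by apply/matrixP => i j; rewrite !mxE; ring.
apply: le_trans (ler_normD _ _) _; rewrite !normrZ (ger0_norm s0) ger0_norm ?subr_ge0 //.
have -> : r = s * r + (1 - s) * r by ring.
by apply: lerD; rewrite ler_wpM2l // subr_ge0.
Qed.

(** The constants are valid for all small radii, so that the estimates for
    finitely many functions can be used on a common ball. *)
Lemma locally_lipschitz n p q (V : set 'rV[R]_n) (f : 'rV[R]_n -> 'M[R]_(p, q))
    (x0 : 'rV[R]_n) : open V -> V x0 -> Ck_on 1 V f ->
  exists K, 0 <= K /\ \forall r \near (0 : R)^'+, forall x,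
    `|x - x0| <= r -> [/\ V x, forall v, `|'D_v f x| <= K * `|v| &
      forall y, `|y - x0| <= r -> `|f y - f x| <= K * `|y - x|].
Proof.
move=> oV Vx0 [df Df].
pose K := \sum_j (`|'D_('e_j) f x0| + 1); exists K.
have K0 : 0 <= K by apply: sumr_ge0 => j _; rewrite addr_ge0.
split=> //.
have : \forall x \near x0, V x /\ forall j, `|'D_('e_j) f x| <= `|'D_('e_j) f x0| + 1.
  apply: filterI; first exact: open_nbhs_nbhs.
  apply: (@filter_forall _ _ _ (nbhs x0)) => j.
  have := Df 'e_j x0 Vx0 => /cvgrPdist_le/(_ 1 ltr01); apply: filterS => x H.
  rewrite -[X in `|X|](subrK ('D_('e_j) f x0)) addrC.
  by apply: le_trans (ler_normD _ _) _; rewrite lerD2l distrC.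
move=> /nbhs_ballP[e /= e0 He]; near=> r.
have Hr x : `|x - x0| <= r -> V x /\ forall v, `|'D_v f x| <= K * `|v|.
  move=> xr; have [|Vx Dx] := He x.
    rewrite -ball_normE /= distrC; apply: le_lt_trans xr _.
    by near: r; exact: nbhs_right_lt.
  split=> // v; rewrite derive_row_sum; last exact: df.
  apply: le_trans (ler_norm_sum _ _ _) _; rewrite mulr_suml; apply: ler_sum => j _.
  by rewrite normrZ mulrC ler_pM // entry_le_mx_norm.
move=> x xr; have [Vx Dx] := Hr x xr; split=> // y yr.
have := @mean_value_le R p q (fun s => f (s *: (y - x) + x))
  (fun s => 'D_(y - x) f (s *: (y - x) + x)) 1 (K * `|y - x|) ler01.
rewrite scale1r subrK scale0r add0r mulr1; apply => s s01.
  have [Vs _] := Hr _ (segment_ball s01 xr yr).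
  rewrite deriveE; last exact: df.
  by apply: (is_derive_curve (is_derive_line _ _ _)); exact: df.
by have [_] := Hr _ (segment_ball s01 xr yr); apply.
Unshelve. all: by end_near. Qed.

(** Along the segment from [x] to [y] the derivative of
    [f z - 'D_(z - x) f x] is bounded by the variation of the partial derivatives,
    which are themselves Lipschitz. *)
Lemma locally_taylor2 n p q (V : set 'rV[R]_n) (f : 'rV[R]_n -> 'M[R]_(p, q))
    (x0 : 'rV[R]_n) : open V -> V x0 -> Ck_on 2 V f ->
  exists K, 0 <= K /\ \forall r \near (0 : R)^'+, forall x y,
    `|x - x0| <= r -> `|y - x0| <= r ->
    `|f y - f x - 'D_(y - x) f x| <= K * `|y - x| ^+ 2.
Proof.
move=> oV Vx0 Cf; have [df Df] := Cf.
have H j := locally_lipschitz oV Vx0 (Df 'e_j).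
pose Kj j := projT1 (cid (H j)).
have HK j : 0 <= Kj j /\ \forall r \near (0 : R)^'+, forall x,
    `|x - x0| <= r -> [/\ V x, forall v, `|'D_v ('D_('e_j) f) x| <= Kj j * `|v| &
      forall y, `|y - x0| <= r -> `|'D_('e_j) f y - 'D_('e_j) f x| <= Kj j * `|y - x|].
  exact: projT2 (cid (H j)).
pose K := \sum_j Kj j; exists K.
have K0 : 0 <= K by apply: sumr_ge0 => j _; exact: (HK j).1.
split=> //.
have [K1 [_ H1]] := locally_lipschitz oV Vx0 (Ck_onW Cf).
near=> r.
have VB x : `|x - x0| <= r -> V x.
  suff /(_ x) : forall x, `|x - x0| <= r -> [/\ V x, forall v, `|'D_v f x| <= K1 * `|v| &
      forall y, `|y - x0| <= r -> `|f y - f x| <= K1 * `|y - x|] by move=> h /h[].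
  by near: r.
have HD x y v : `|x - x0| <= r -> `|y - x0| <= r ->
    `|'D_v f y - 'D_v f x| <= K * `|v| * `|y - x|.
  move=> xr yr; rewrite !derive_row_sum; [|by apply: df; exact: VB..].
  rewrite -sumrB; apply: le_trans (ler_norm_sum _ _ _) _.
  rewrite !mulr_suml; apply: ler_sum => j _.
  rewrite -scalerBr normrZ mulrAC [in leRHS]mulrC ler_pM // ?entry_le_mx_norm //.
  suff /(_ j x xr) [_ _] : forall j x,
    `|x - x0| <= r -> [/\ V x, forall v, `|'D_v ('D_('e_j) f) x| <= Kj j * `|v| &
      forall y, `|y - x0| <= r -> `|'D_('e_j) f y - 'D_('e_j) f x| <= Kj j * `|y - x|]
        by apply.
  by near: r; apply: filter_forall => j0; exact: (HK j0).2.
move=> x y xr yr.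
have := @mean_value_le R p q (fun s => f (s *: (y - x) + x) - s *: 'D_(y - x) f x)
  (fun s => 'D_(y - x) f (s *: (y - x) + x) - 'D_(y - x) f x) 1 (K * `|y - x| ^+ 2) ler01.
rewrite scale1r subrK scale0r add0r mulr1 scale0r subr0 scale1r addrAC; apply => s s01.
  have Vs := VB _ (segment_ball s01 xr yr).
  apply: is_deriveB.
    rewrite deriveE; last exact: df.
    by apply: (is_derive_curve (is_derive_line _ _ _)); exact: df.
  have := is_derive_line 0 ('D_(y - x) f x) s.
  by under eq_fun do rewrite addr0.
apply: le_trans (HD _ _ _ xr (segment_ball s01 xr yr)) _.
rewrite addrK normrZ expr2 [in leRHS]mulrA ler_wpM2l ?mulr_ge0 //.
by have /andP[s0 s1] := s01; rewrite (ger0_norm s0) ler_piMl.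
Unshelve. all: by end_near. Qed.

Lemma is_diff_of_quadratic (V W : normedModType R) (f : V -> W)
    (L : {linear V -> W}) (x : V) (C : R) : continuous L -> 0 <= C ->
  (\forall h \near 0, `|f (h + x) - f x - L h| <= C * `|h| ^+ 2) -> is_diff x f L.
Proof.
move=> cL C0 H.
have D : f \o shift x = cst (f x) + L +o_ 0 id.
  apply/eqaddoP => e e0.
  have C1 : 0 < C + 1 by rewrite ltr_wpDl.
  near=> h.
  rewrite /= opprD addrA.
  apply: le_trans (_ : C * `|h| ^+ 2 <= _); first by near: h.
  rewrite expr2 mulrA ler_wpM2r //.
  apply: le_trans (_ : (C + 1) * `|h| <= _); first by rewrite ler_wpM2r // lerDl.
  rewrite mulrC -ler_pdivlMr //; apply: ltW.
  by near: h; apply: nbhs0_lt; exact: divr_gt0.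
have E := diff_unique cL D.
by apply: DiffDef => //; apply/diff_locallyP; rewrite E.
Unshelve. all: by end_near. Qed.

End LocalEstimates.

(** * Total differential equations *)

Section Frobenius.
Context {R : realType}.

Section ClampBox.
Variables (n : nat) (p : 'rV[R]_n) (r : R).
Hypothesis r0 : 0 <= r.

Let clamp1 (c t : R) := if t <= c - r then c - r else if c + r <= t then c + r else t.

(** Retraction onto the closed ball of radius [r] around [p]; the balls of the
    maximum norm are boxes, so it can be taken coordinatewise. *)
Definition clamp_box (x : 'rV[R]_n) : 'rV[R]_n := \row_j clamp1 (p 0 j) (x 0 j).

Lemma clamp_box_ball x : `|clamp_box x - p| <= r.
Proof.
apply: mx_norm_le => // i j; rewrite !mxE ler_norml /clamp1 ord1; have r0' := r0.
by case: (leP (x 0 j) (p 0 j - r)) => ?; case: (leP (p 0 j + r) (x 0 j)) => ?; lra.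
Qed.

Lemma clamp_box_id x : `|x - p| <= r -> clamp_box x = x.
Proof.
move=> xr; apply/rowP => j; rewrite mxE /clamp1.
have := le_trans (entry_le_mx_norm (x - p) 0 j) xr; rewrite !mxE ler_norml.
by case: (leP (x 0 j) (p 0 j - r)) => ?; case: (leP (p 0 j + r) (x 0 j)) => ?; lra.
Qed.

Lemma clamp_box_lipschitz x y : `|clamp_box x - clamp_box y| <= `|x - y|.
Proof.
apply: mx_norm_le => // i j; apply: le_trans (entry_le_mx_norm _ 0 j).
rewrite !mxE ler_norml /clamp1; have r0' := r0.
by case: (leP (x 0 j) (p 0 j - r)) => ?; case: (leP (p 0 j + r) (x 0 j)) => ?;
  case: (leP (y 0 j) (p 0 j - r)) => ?; case: (leP (p 0 j + r) (y 0 j)) => ?;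
  case: (lerP (x 0 j) (y 0 j)) => ?; lra.
Qed.

End ClampBox.

Variables (n r : nat) (V : set 'rV[R]_n) (p : 'rV[R]_n).
Variables (sigma : 'rV[R]_n -> 'M[R]_(r, n)) (pi : 'M[R]_(n, r)).
Hypotheses (oV : open V) (Vp : V p).
Hypothesis sigma_smooth : forall k, Ck_on k V sigma.
Hypothesis sigma_pi : forall x, V x -> sigma x *m pi = 1%:M.
Hypothesis sigma_sym : forall x, V x -> forall h k : 'rV[R]_r,
  k *m 'D_(h *m sigma x) sigma x = h *m 'D_(k *m sigma x) sigma x.

Let estimates : exists (K K2 rho : R), [/\ 0 <= K, 0 <= K2, 0 < rho &
  forall x, `|x - p| <= rho -> [/\ V x, forall v, `|'D_v sigma x| <= K * `|v|,
    `|sigma x| <= K &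
    forall y, `|y - p| <= rho -> `|sigma y - sigma x| <= K * `|y - x| /\
      `|sigma y - sigma x - 'D_(y - x) sigma x| <= K2 * `|y - x| ^+ 2]].
Proof.
have [K [K0 HK]] := locally_lipschitz oV Vp (sigma_smooth 1).
have [K2 [K20 HK2]] := locally_taylor2 oV Vp (sigma_smooth 2).
have [rho [rho0 rho1 H1 H2]] : exists rho, [/\ 0 < rho, rho < 1, forall x,
    `|x - p| <= rho -> [/\ V x, forall v, `|'D_v sigma x| <= K * `|v| &
      forall y, `|y - p| <= rho -> `|sigma y - sigma x| <= K * `|y - x|] &
    forall x y, `|x - p| <= rho -> `|y - p| <= rho ->
    `|sigma y - sigma x - 'D_(y - x) sigma x| <= K2 * `|y - x| ^+ 2].
  suff : \forall rho \near (0 : R)^'+, [/\ 0 < rho, rho < 1, forall x,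
    `|x - p| <= rho -> [/\ V x, forall v, `|'D_v sigma x| <= K * `|v| &
      forall y, `|y - p| <= rho -> `|sigma y - sigma x| <= K * `|y - x|] &
    forall x y, `|x - p| <= rho -> `|y - p| <= rho ->
    `|sigma y - sigma x - 'D_(y - x) sigma x| <= K2 * `|y - x| ^+ 2].
    by move=> /filter_ex.
  near=> rho; split.
  - by near: rho; exact: nbhs_right_gt.
  - by near: rho; exact: nbhs_right_lt.
  - by near: rho.
  - by near: rho.
have pp : `|p - p| <= rho by rewrite subrr normr0 ltW.
exists (K + `|sigma p|), K2, rho; split=> //; first by rewrite addr_ge0.
move=> x xr; have [Vx Dx Lx] := H1 x xr; split=> // [v||y yr].
- by apply: le_trans (Dx v) _; rewrite ler_wpM2r // lerDl.
- rewrite -[X in `|X|](subrK (sigma p)); apply: le_trans (ler_normD _ _) _.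
  rewrite lerD2r; have [_ _ /(_ x xr) H] := H1 p pp; apply: le_trans H _.
  by rewrite ler_piMr // (le_trans xr) // ltW.
- split; last exact: H2.
  by apply: le_trans (Lx y yr) _; rewrite ler_wpM2r // lerDl.
Unshelve. all: by end_near. Qed.

(** [z t] solves the ordinary differential equation along the ray [s |-> s *: t].
    Composing [sigma] with the retraction onto the ball of radius [rho] makes the
    equation global and Lipschitz, and for small [t] the solution does not leave
    the ball, where the retraction changes nothing. *)
Let rays : exists (K K2 e rho : R) (z : 'rV[R]_r -> R -> 'rV[R]_n),
  [/\ [/\ 0 <= K, 0 <= K2, 0 < e & r%:R * K * e <= 2^-1],
  forall x, `|x - p| <= rho -> [/\ V x, forall v, `|'D_v sigma x| <= K * `|v|,
    `|sigma x| <= K &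
    forall y, `|y - p| <= rho -> `|sigma y - sigma x| <= K * `|y - x| /\
      `|sigma y - sigma x - 'D_(y - x) sigma x| <= K2 * `|y - x| ^+ 2] &
  forall t, `|t| <= e -> z t 0 = p /\ forall s, 0 <= s <= 1 ->
    `|z t s - p| <= rho /\ is_derive s 1 (z t) (t *m sigma (z t s))].
Proof.
have [K [K2 [rho [K0 K20 rho0 H]]]] := estimates.
pose L := r%:R * K; have L0 : 0 <= L by rewrite mulr_ge0.
have L1 : 0 < L + 1 by rewrite ltr_wpDl.
pose e := Num.min (2^-1) rho / (L + 1).
have m0 : 0 < Num.min (2^-1) rho by rewrite lt_min rho0 invr_gt0 ltr0n.
have e0 : 0 < e by rewrite divr_gt0.
have Le : L * e <= Num.min (2^-1) rho.
  by rewrite /e mulrA ler_pdivrMr // mulrC ler_wpM2l ?(ltW m0) // lerDl.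
have Le2 : L * e <= 2^-1 by apply: le_trans Le _; rewrite ge_min lexx.
have Ler : L * e <= rho by apply: le_trans Le _; rewrite ge_min lexx orbT.
have Hz t : exists z : R -> 'rV[R]_n, `|t| <= e -> z 0 = p /\ forall s, 0 <= s <= 1 ->
    `|z s - p| <= rho /\ is_derive s 1 z (t *m sigma (z s)).
  have [te|] := leP `|t| e; last by exists (fun=> 0).
  pose f x := t *m sigma (clamp_box p rho x).
  have Bc := clamp_box_ball p (ltW rho0).
  have Lte : L * `|t| <= L * e by rewrite ler_wpM2l.
  have fb x : `|f x| <= L * `|t|.
    apply: le_trans (norm_mulmx_le _ _) _; rewrite mulrCA mulrC ler_wpM2r //.
    by rewrite ler_wpM2l //; have [] := H _ (Bc x).
  have fc x y : `|f x - f y| <= 2^-1 * `|x - y|.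
    rewrite /f -mulmxBr; apply: le_trans (norm_mulmx_le _ _) _.
    apply: le_trans (_ : r%:R * (`|t| * (K * `|x - y|)) <= _).
      rewrite ler_wpM2l // ler_wpM2l //.
      have [_ _ _ /(_ _ (Bc x)) [h _]] := H _ (Bc y).
      apply: le_trans h _; rewrite ler_wpM2l //.
      exact: clamp_box_lipschitz (ltW rho0) _ _.
    rewrite [`|t| * _]mulrCA !mulrA -/L ler_wpM2r //.
    exact: le_trans Lte Le2.
  have [z [z0 dz]] := picard p fc fb.
  exists z => _; split=> // s s01; have /andP[s0 s1] := s01.
  have zb : `|z s - p| <= rho.
    rewrite -z0; apply: le_trans (_ : L * `|t| * s <= _).
      apply: (@mean_value_le _ _ _ z (f \o z)) => // u /andP[u0 us]; last exact: fb.
      by apply: dz; rewrite u0 (le_trans us).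
    apply: le_trans (le_trans Lte Ler); rewrite ler_piMr //.
    exact: mulr_ge0.
  split=> //; have := dz s s01.
  by rewrite /f clamp_box_id.
exists K, K2, e, rho, (fun t => projT1 (cid (Hz t))); split=> // t te.
exact: projT2 (cid (Hz t)) te.
Qed.

(** Along each ray the equation [dg = sigma (g)] is an ordinary one; the point is
    that the solution [g] is also differentiable across the rays.  For neighbouring
      rays [t] and [t'] the
    defect [z t' s - z t s - s *: ((t' - t) *m sigma (z t s))] satisfies, thanks
    to the integrability condition, a linear differential inequality with a
    source that is quadratic in [t' - t]. *)
Lemma frobenius_parametrization : exists (e : R) (g : 'rV[R]_r -> 'rV[R]_n),
  [/\ 0 < e, g 0 = p &
   forall t, `|t| < e -> [/\ V (g t), g t *m pi = p *m pi + t,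
     differentiable g t & forall h, 'D_h g t = h *m sigma (g t)]].
Proof.
have [K [K2 [e [rho [z [[K0 K20 e0 Ke] HB Hz]]]]]] := rays.
have r0 : (0 : R) <= r%:R by [].
have bnd t (B : 'M[R]_(r, n)) (b : R) : `|t| <= e -> `|B| <= K * b -> 0 <= b ->
    `|t *m B| <= 2^-1 * b.
  move=> te Bb b0; apply: le_trans (norm_mulmx_le _ _) _.
  apply: le_trans (_ : r%:R * (e * (K * b)) <= _).
    by rewrite ler_wpM2l // ler_pM.
  by rewrite (_ : _ * _ = r%:R * K * e * b); [rewrite ler_wpM2r|ring].
have z_lip t t' : `|t| <= e -> `|t'| <= e -> forall s, 0 <= s <= 1 ->
    `|z t' s - z t s| <= 2 * (r%:R * (`|t' - t| * K)).
  move=> te te'; have [z0 dz] := Hz t te; have [z0' dz'] := Hz t' te'.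
  have c0 : 0 <= r%:R * (`|t' - t| * K) by rewrite !mulr_ge0.
  apply: (absorb_derive (a := 2^-1) (dd := fun s => t' *m sigma (z t' s) - t *m sigma
    (z t s))) => //.
  - by rewrite lexx invr_ge0 ler0n.
  - by rewrite z0 z0' subrr.
  - by move=> s s01; apply: is_deriveB; [exact: (dz' s s01).2|exact: (dz s s01).2].
  - move=> s s01; have [zb _] := dz s s01; have [zb' _] := dz' s s01.
    have [_ _ sb /(_ _ zb') [sl _]] := HB _ zb.
    have -> : t' *m sigma (z t' s) - t *m sigma (z t s) =
        t' *m (sigma (z t' s) - sigma (z t s)) + (t' - t) *m sigma (z t s).
      by rewrite mulmxBr mulmxBl addrA subrK.
    apply: le_trans (ler_normD _ _) _; apply: lerD; first exact: bnd.
    apply: le_trans (norm_mulmx_le _ _) _.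
    by rewrite ler_wpM2l // ler_wpM2l.
have z_scale t a : `|t| <= e -> 0 <= a <= 1 -> z (a *: t) 1 = z t a.
  move=> te a01; have /andP[a0 a1] := a01.
  have ate : `|a *: t| <= e by rewrite normrZ (ger0_norm a0) (le_trans _ te) // ler_piMl.
  have [z0 dz] := Hz t te; have [z0' dz'] := Hz _ ate.
  have in01 s : 0 <= s <= 1 -> 0 <= a * s <= 1.
    by move=> /andP[s0 s1]; rewrite mulr_ge0 //= (le_trans _ a1) // ler_piMr.
  have ds : forall s : R, is_derive s 1 (fun s => a * s) a.
    move=> s; have := is_derive_line 0 a s;
      rewrite (_ : (fun s => _) = (fun s => a * s)) //.
    by apply/funext => x; rewrite addr0 /GRing.scale /= mulrC.
  have := @absorb_derive R 1 n (fun s => z (a *: t) s - z t (a * s))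
    (fun s => (a *: t) *m sigma (z (a *: t) s) - a *: (t *m sigma (z t (a * s))))
      (2^-1) 0.
  rewrite lexx invr_ge0 ler0n => /(_ isT (lexx 0)) H.
  have H0 : z (a *: t) 0 - z t (a * 0) = 0 by rewrite mulr0 z0 z0' subrr.
  apply/eqP; rewrite -subr_eq0 -normr_le0.
  have := H H0 _ _ 1; rewrite mulr0 mulr1 ler01 lexx; apply=> // s s01.
    apply: is_deriveB; first exact: (dz' s s01).2.
    exact: is_derive_comp_curve (ds s) (dz _ (in01 s s01)).2.
  have [zb _] := dz _ (in01 s s01); have [zb' _] := dz' s s01.
  rewrite addr0 -scalemxAl -scalerBr -mulmxBr normrZ (ger0_norm a0).
  apply: le_trans (_ : `|t *m (sigma (z (a *: t) s) - sigma (z t (a * s)))| <= _).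
    by rewrite ler_piMl.
  have [_ _ _ /(_ _ zb') [sl _]] := HB _ zb.
  exact: bnd.
pose g t := z t 1.
have one01 : 0 <= (1 : R) <= 1 by rewrite ler01 lexx.
have gb t : `|t| <= e -> `|g t - p| <= rho.
  by move=> te; exact: ((Hz t te).2 1 one01).1.
have gpi t : `|t| <= e -> g t *m pi = p *m pi + t.
  move=> te; have [z0 dz] := Hz t te.
  have H : `|(z t 1 *m pi - 1 *: t) - (z t 0 *m pi - 0 *: t)| <= 0 * 1.
    apply: (@mean_value_le R 1 r (fun s => z t s *m pi - s *: t)
      (fun s => t *m sigma (z t s) *m pi - t)) => // s s01; have [zb dzs] := dz s s01.
      apply: is_deriveB; last first.
        by have := is_derive_line 0 t s; under eq_fun do rewrite addr0.
      apply: is_derive_eq (is_derive_mulmx dzs (is_derive_cst pi s 1)) _.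
      by rewrite mulmx0 addr0.
    have [Vz _ _ _] := HB _ zb.
    by rewrite -mulmxA sigma_pi // mulmx1 subrr normr0.
  move: H; rewrite mul0r normr_le0 z0 scale1r scale0r subr0 => /eqP/subr0_eq/eqP.
  by rewrite subr_eq => /eqP.
pose C := 2 * (r%:R * e * K2 * (2 * r%:R * K) ^+ 2 + r%:R * K * (2 * r%:R * K)).
have C0 : 0 <= C.
  by rewrite mulr_ge0 // addr_ge0 // !mulr_ge0 ?sqr_ge0 // ltW.
have main t t' : `|t| <= e -> `|t'| <= e ->
    `|g t' - g t - (t' - t) *m sigma (g t)| <= C * `|t' - t| ^+ 2.
  move=> te te'; have [z0 dz] := Hz t te; have [z0' dz'] := Hz t' te'.
  set h := t' - t.
  have := @absorb_derive R 1 n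
    (fun s => z t' s - z t s - s *: (h *m sigma (z t s)))
    (fun s => t' *m sigma (z t' s) - t *m sigma (z t s) -
       (h *m sigma (z t s) + s *: (h *m 'D_(t *m sigma (z t s)) sigma (z t s))))
    (2^-1) (C / 2 * `|h| ^+ 2).
  rewrite lexx invr_ge0 ler0n z0 z0' scale0r !subrr => /(_ isT) H.
  have c0 : 0 <= C / 2 * `|h| ^+ 2 by rewrite mulr_ge0 // divr_ge0.
  have := H c0 erefl _ _ 1 one01; rewrite scale1r mulrA (mulrC 2) divfK ?pnatr_eq0 //.
  apply=> s s01; have [zb dzs] := dz s s01; have [zb' dzs'] := dz' s s01;
      have [Vz Db sb /(_ _ zb') [sl s2]] := HB _ zb; have /andP[s0 s1] := s01.
    have dzz : is_derive s 1 (fun s => z t' s - z t s) (t' *m sigma (z t' s) - t *m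
      sigma (z t s)).
      exact: is_deriveB dzs' dzs.
    apply: is_deriveB dzz _.
    have dsig : is_derive s 1 (fun x => sigma (z t x)) ('D_(t *m sigma (z t s)) sigma
      (z t s)).
      rewrite deriveE; last exact: (sigma_smooth 1).1.
      by apply: is_derive_curve dzs _; exact: (sigma_smooth 1).1.
    have dhs := is_derive_mulmx (is_derive_cst h s 1) dsig.
    rewrite mul0mx add0r in dhs.
    have -> : (fun s => s *: (h *m sigma (z t s))) = (fun s => s%:M *m (h *m sigma (z t
      s))).
      by apply/funext => x; rewrite mul_scalar_mx.
    have dsc : is_derive s 1 (fun s : R => s%:M : 'M[R]_1) 1%:M.
      apply: is_derive_mxP => i j; rewrite !ord1 mxE /= mulr1n.
      under eq_fun do rewrite mxE /= mulr1n.
      exact: is_derive_id.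
    by apply: is_derive_eq (is_derive_mulmx dsc dhs) _; rewrite !mul_scalar_mx scale1r.
  set w := z t s in zb dzs Vz Db sb sl s2 *; set w' := z t' s in zb' dzs' sl s2 *.
  have wl : `|w' - w| <= 2 * r%:R * K * `|h|.
    by apply: le_trans (z_lip t t' te te' s s01) _; rewrite le_eqVlt; apply/orP; left;
      apply/eqP; ring.
  have dsw : differentiable sigma w by exact: (sigma_smooth 1).1.
  have DB (u v : 'rV[R]_n) : 'D_(u + v) sigma w = 'D_u sigma w + 'D_v sigma w.
    by rewrite !deriveE // linearD.
  have DZ (a : R) (u : 'rV[R]_n) : 'D_(a *: u) sigma w = a *: 'D_u sigma w.
    by rewrite !deriveE // linearZ.
  (* The integrability condition exchanges [h] and [t] here. *)
  have -> : t' *m sigma w' - t *m sigma w -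
       (h *m sigma w + s *: (h *m 'D_(t *m sigma w) sigma w)) =
     t *m 'D_(w' - w - s *: (h *m sigma w)) sigma w +
     (t *m (sigma w' - sigma w - 'D_(w' - w) sigma w) + h *m (sigma w' - sigma w)).
    rewrite (DB (w' - w) (- (s *: (h *m sigma w)))) -scaleNr DZ [in X in _ = X +
      _]mulmxDr.
    rewrite -[X in _ = _ + X + _]scalemxAr sigma_sym //.
    set Y := t *m 'D_(h *m sigma w) sigma w.
    rewrite /h !(mulmxBr, mulmxBl, mulmxDr, mulmxDl) scaleNr.
    by apply/matrixP => i j; rewrite !mxE; ring.
  apply: le_trans (ler_normD _ _) _; apply: lerD; first by apply: bnd => //; exact: Db.
  rewrite /C [X in X / 2]mulrC mulfK ?pnatr_eq0 // mulrDl.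
  apply: le_trans (ler_normD _ _) _; apply: lerD.
    apply: le_trans (norm_mulmx_le _ _) _.
    apply: le_trans (_ : r%:R * (e * (K2 * (2 * r%:R * K * `|h|) ^+ 2)) <= _); last first.
      by rewrite le_eqVlt; apply/orP; left; apply/eqP; ring.
    rewrite ler_wpM2l // ler_pM //; apply: le_trans s2 _.
    by rewrite ler_wpM2l // lerXn2r ?nnegrE // !mulr_ge0.
  apply: le_trans (norm_mulmx_le _ _) _.
  apply: le_trans (_ : r%:R * (`|h| * (K * (2 * r%:R * K * `|h|))) <= _); last first.
    by rewrite le_eqVlt; apply/orP; left; apply/eqP; ring.
  by rewrite ler_wpM2l // ler_wpM2l // (le_trans sl) // ler_wpM2l.
exists e, g; split=> //.
  by have := z_scale 0 0; rewrite normr0 ltW // lexx ler01 scale0r => /(_ isT isT);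
    rewrite /g => ->; have [] := Hz 0; rewrite ?normr0 // ltW.
move=> t te; have te' := ltW te.
have [Vg _ _ _] := HB _ (gb t te').
pose mulr_sigma : {linear 'rV[R]_r -> 'rV[R]_n} := mulmxr (sigma (g t)).
have idg : is_diff t g mulr_sigma.
  apply: (@is_diff_of_quadratic _ _ _ _ _ _ C) => //; first exact: mulmxr_continuous.
  have hlt : \forall h \near (0 : 'rV[R]_r), `|h| < e - `|t|.
    by apply: nbhs_norm0_lt; rewrite subr_gt0.
  near=> h.
  have := main t (h + t) te'; rewrite addrK; apply.
  apply: le_trans (ler_normD _ _) _; rewrite -lerBrDr; apply: ltW.
  by near: h; exact: hlt.
have dg : differentiable g t by exact: (@ex_diff _ _ _ _ _ _ _ idg).
split=> //; first exact: gpi.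
by move=> h; rewrite deriveE // (@diff_val _ _ _ _ _ _ _ idg).
Unshelve. all: by end_near. Qed.

(** The equation itself improves the regularity: if [g] is of class C^k, then so
    is its derivative [sigma (g)]. *)
Lemma frobenius_smooth (e : R) (g : 'rV[R]_r -> 'rV[R]_n) :
  (forall t, `|t| < e -> [/\ V (g t), differentiable g t &
    forall h, 'D_h g t = h *m sigma (g t)]) ->
  smooth_on [set t | `|t| < e] g.
Proof.
move=> Hg.
have oU : open [set t : 'rV[R]_r | `|t| < e].
  rewrite (_ : [set t | _] = ball (0 : 'rV[R]_r) e); first exact: ball_open.
  by rewrite -ball_normE; apply/seteqP; split=> t /=; rewrite sub0r normrN.
elim=> [|k IH]; first by move=> t /Hg[_ dg _]; exact: differentiable_continuous.
split=> [t /Hg[]//|v].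
have Cs : Ck_on k [set t | `|t| < e] (fun t => sigma (g t)).
  by apply: (Ck_on_comp_mx oU oV _ IH (sigma_smooth k)) => t /Hg[].
have := Ck_on_mulmx oU (Ck_on_cst k _ v) Cs.
by apply: eq_Ck_on => // t /Hg[_ _ ->].
Qed.

End Frobenius.

(** * Generalized eigenspaces *)

Section RieszIndex.
Variables (F : fieldType) (n : nat) (B : 'M[F]_n).

Lemma kermx_exp_mono p q : (p <= q)%N -> (kermx (B ^+ p) <= kermx (B ^+ q))%MS.
Proof.
move=> pq; apply/sub_kermxP.
by rewrite -(subnKC pq) exprD -mulmxE mulmxA mulmx_ker mul0mx.
Qed.

Lemma kermx_exp_stable r : (kermx (B ^+ r) == kermx (B ^+ r.+1))%MS ->
  forall q, (kermx (B ^+ q) <= kermx (B ^+ r))%MS.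
Proof.
move=> /andP[_ st] q; have [/kermx_exp_mono//|/ltnW rq] := leqP q r.
rewrite -(subnKC rq); elim: (q - r)%N => [|j IH]; first by rewrite addn0.
apply: submx_trans IH; apply/sub_kermxP.
have : (kermx (B ^+ (r + j.+1)) *m B ^+ j <= kermx (B ^+ r.+1))%MS.
  apply/sub_kermxP; rewrite -mulmxA mulmxE -exprD addnS addnC -addnS -mulmxE.
  exact: mulmx_ker.
move=> /submx_trans/(_ st)/sub_kermxP.
by rewrite -mulmxA mulmxE -exprD (addnC j r).
Qed.

(** The kernels of the powers grow by at least one dimension until they become
    stationary, so that they are stationary from the exponent [n] on. *)
Lemma riesz_index_kermx (r : nat) : (kermx (B ^+ r) == kermx (B ^+ r.+1))%MS ->
  (forall q, (kermx (B ^+ q) == kermx (B ^+ q.+1))%MS -> (r <= q)%N) ->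
  (kermx (B ^+ r) :=: kermx (B ^+ n))%MS.
Proof.
move=> st rmin.
have rn : (r <= n)%N.
  rewrite leqNgt; apply/negP => nr.
  suff H q : (q <= n.+1)%N -> (q <= \rank (kermx (B ^+ q)))%N.
    by have := leq_trans (H n.+1 (leqnn _)) (rank_leq_row _); rewrite ltnn.
  elim: q => // q IH qn; apply: (leq_ltn_trans (IH (ltnW qn))).
  rewrite ltn_neqAle mxrankS ?kermx_exp_mono // andbT.
  apply: contraTneq (leq_trans qn nr) => E; rewrite -leqNgt.
  apply: rmin; apply/eqmxP/eqmx_sym.
  have/mxrank_leqif_eq/geq_leqif : (kermx (B ^+ q) <= kermx (B ^+ q.+1))%MS by rewrite
    kermx_exp_mono.
  by rewrite E leqnn => /esym/eqmxP/eqmx_sym.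
by apply/eqmxP; rewrite kermx_exp_mono // kermx_exp_stable.
Qed.

End RieszIndex.

(** When the [lam k] are the eigenvalues of [A], the kernel of this matrix is the
    sum of the generalized eigenspaces indexed by [S], and its image is the sum of
    the others. *)
Definition spectral_mx (F : fieldType) (n s : nat) (A : 'M[F]_n) (lam : 'I_s -> F)
    (S : {set 'I_s}) : 'M[F]_n := \prod_(k in S) (A - (lam k)%:M) ^+ n.

Section SpectralMatrixSucc.
Variables (F : fieldType) (n' s : nat).
Local Notation n := n'.+1.
Variables (A : 'M[F]_n) (lam : 'I_s -> F) (kappa : n.-tuple 'I_s).
Hypothesis lam_inj : injective lam.
Hypothesis char_polyA : char_poly A = \prod_(k <- kappa) ('X - (lam k)%:P).

Let pS (S : {set 'I_s}) : {poly F} := \prod_(k in S) ('X - (lam k)%:P) ^+ n.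

Let coprime_factors i j : j != i ->
  coprimep (('X - (lam i)%:P) ^+ n) (('X - (lam j)%:P) ^+ n).
Proof.
move=> ji; apply/coprimep_expl/coprimep_expr.
by rewrite coprimep_XsubC root_XsubC (inj_eq lam_inj).
Qed.

Let coprime_pS S : coprimep (pS S) (pS (~: S)).
Proof.
rewrite /pS (@big_morph _ _ (fun p => coprimep p _) true andb); last 2 first.
- by move=> p q; rewrite coprimepMl.
- by rewrite coprime1p.
rewrite big_all_cond; apply/allP => i _; apply/implyP => iS.
rewrite (@big_morph _ _ (fun q => coprimep _ q) true andb); last 2 first.
- by move=> p q; rewrite coprimepMr.
- by rewrite coprimep1.
rewrite big_all_cond; apply/allP => j _; apply/implyP; rewrite inE => jS.
by apply: coprime_factors; apply: contraNneq jS => ->.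
Qed.

Let horner_pS S : horner_mx A (pS S) = spectral_mx A lam S.
Proof.
rewrite rmorph_prod /=; apply: eq_bigr => k _.
by rewrite rmorphXn rmorphB /= horner_mx_X horner_mx_C.
Qed.

Let pS_annihilates S : horner_mx A (pS S * pS (~: S)) = 0.
Proof.
suff /dvdpP[q ->] : char_poly A %| pS S * pS (~: S) by rewrite rmorphM /=
  Cayley_Hamilton mulr0.
have -> : pS S * pS (~: S) = (\prod_k ('X - (lam k)%:P)) ^+ n.
  rewrite -prodrXl [RHS](bigID (mem S)) /=; congr (_ * _).
  by apply: eq_bigl => k; rewrite inE.
rewrite char_polyA -[X in _ ^+ X](size_tuple kappa).
elim: (tval kappa) => [|k r IH]; first by rewrite big_nil dvd1p.
rewrite big_cons exprS dvdp_mul //.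
by rewrite (bigD1 k) //= dvdp_mulr.
Qed.

Lemma spectral_mxP_succ S :
  [/\ A *m spectral_mx A lam S = spectral_mx A lam S *m A,
      spectral_mx A lam S *m spectral_mx A lam (~: S) = 0,
      exists U W, spectral_mx A lam S *m U + spectral_mx A lam (~: S) *m W = 1%:M
        /\ spectral_mx A lam (~: S) *m W = W *m spectral_mx A lam (~: S) &
      (kermx (spectral_mx A lam S) :=: \sum_(k in S) geigenspace A (lam k))%MS].
Proof.
rewrite -!horner_pS; split.
- transitivity (horner_mx A ('X * pS S)); first by rewrite rmorphM /= horner_mx_X.
  by rewrite mulrC rmorphM /= horner_mx_X.
- by rewrite -(pS_annihilates S) rmorphM.
- have /Bezout_eq1_coprimepP [[u w] /= E] := coprime_pS S.
  exists (horner_mx A u), (horner_mx A w); rewrite !mulmxE -!rmorphM -!rmorphD.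
  by rewrite [pS S * u]mulrC [pS (~: S) * w]mulrC E rmorph1.
- rewrite -[kermx _]/(kermxpoly A (pS S)).
  by apply: kermxpoly_prod => i j _ _; exact: coprime_factors.
Qed.

End SpectralMatrixSucc.

Section SpectralMatrix.
Variables (F : fieldType) (n s : nat).
Variables (A : 'M[F]_n) (lam : 'I_s -> F) (kappa : n.-tuple 'I_s).
Hypothesis lam_inj : injective lam.
Hypothesis char_polyA : char_poly A = \prod_(k <- kappa) ('X - (lam k)%:P).

Lemma spectral_mxP S :
  [/\ A *m spectral_mx A lam S = spectral_mx A lam S *m A,
      spectral_mx A lam S *m spectral_mx A lam (~: S) = 0,
      exists U W, spectral_mx A lam S *m U + spectral_mx A lam (~: S) *m W = 1%:M
        /\ spectral_mx A lam (~: S) *m W = W *m spectral_mx A lam (~: S) &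
      (kermx (spectral_mx A lam S) :=: \sum_(k in S) geigenspace A (lam k))%MS].
Proof.
move: A kappa char_polyA; case: n => [|n'] B kap EB.
  split; rewrite ?[LHS]thinmx0 //; last by apply/eqmxP;
    rewrite [kermx _]thinmx0 !sub0mx [X in (X <= _)%MS]thinmx0 sub0mx.
    by rewrite [RHS]thinmx0.
  by exists 0, 0; rewrite [RHS]thinmx0 [LHS]thinmx0; split=> //;
    rewrite [LHS]thinmx0 [RHS]thinmx0.
exact: (spectral_mxP_succ lam_inj EB).
Qed.

Lemma spectral_mx_ker S p (v : 'M[F]_(p, n)) :
  (v *m spectral_mx A lam S == 0) = (v <= spectral_mx A lam (~: S))%MS.
Proof.
apply/eqP/idP => [v0|/submxP[w ->]].
  have [_ _ [U [W [E EW]]] _] := spectral_mxP S.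
  have := congr1 (mulmx v) E; rewrite mulmxDr !mulmxA v0 mul0mx add0r mulmx1 => <-.
  by rewrite -mulmxA EW mulmxA submxMl.
by have [_ + _ _] := spectral_mxP (~: S); rewrite finset.setCK -mulmxA => ->;
  rewrite mulmx0.
Qed.

(** By Bezout's identity the image of [spectral_mx A lam S] meets its kernel in 0
    only. *)
Lemma spectral_mx_sqr S p (v : 'M[F]_(p, n)) :
  v *m spectral_mx A lam S *m spectral_mx A lam S = 0 -> v *m spectral_mx A lam S = 0.
Proof.
move=> v0; have [_ PP [U [W [E _]]] _] := spectral_mxP S.
have := congr1 (mulmx (v *m spectral_mx A lam S)) E.
by rewrite mulmxDr mulmx1 mulmxA v0 mul0mx add0r mulmxA -(mulmxA v) PP mulmx0 mul0mx =>
  <-.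
Qed.

Lemma spectral_mx_geigenspace S :
  (spectral_mx A lam (~: S) :=: \sum_(k in S) geigenspace A (lam k))%MS.
Proof.
have [_ _ _ K] := spectral_mxP S; apply: eqmx_trans K; apply/eqmxP/andP; split.
  by apply/sub_kermxP/eqP; rewrite spectral_mx_ker.
by rewrite -spectral_mx_ker; apply/eqP; exact: mulmx_ker.
Qed.

Lemma rank_spectral_mx S :
  \rank (spectral_mx A lam (~: S)) = (\sum_(k in S) \rank (geigenspace A (lam k)))%N.
Proof.
rewrite spectral_mx_geigenspace; apply/mxdirectP.
by apply: mxdirect_sum_geigenspace => i j _ _; exact: lam_inj.
Qed.

End SpectralMatrix.

Lemma geigenspace_kermx (F : fieldType) (n : nat) (B : 'M[F]_n) (a : F) :
  (geigenspace B a :=: kermx ((B - a%:M) ^+ n))%MS.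
Proof.
case: n B => [|n'] B; last by rewrite geigenspaceE.
by apply/eqmxP; rewrite [kermx _]thinmx0 [geigenspace _ _]thinmx0 submx_refl.
Qed.

Lemma char_poly_real_split (R : rcfType) (n s : nat) (A : 'M[R]_n) (lam : 'I_s -> R) :
  (forall z : complex R, eigenvalue (map_mx (real_complex R) A) z
     <-> exists k : 'I_s, z = real_complex R (lam k)) ->
  exists kappa : n.-tuple 'I_s, char_poly A = \prod_(k <- kappa) ('X - (lam k)%:P).
Proof.
move=> spec.
set f := real_complex R; set p := char_poly A.
have [r Er] := closed_field_poly_normal (map_poly f p).
have mp : map_poly f p = char_poly (map_mx f A) by rewrite /p map_char_poly.
rewrite mp (monicP (char_poly_monic _)) scale1r in Er.
have Hr z : z \in r -> exists k, z = f (lam k).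
  by move=> zr; apply/spec; rewrite eigenvalue_root_char Er root_prod_XsubC.
have [kap Ek] : exists kap : seq 'I_s, r = [seq f (lam k) | k <- kap].
  elim: r {Er} Hr => [|z r IH] Hr; first by exists [::].
  have [k ->] := Hr z (mem_head _ _).
  have [|kap ->] := IH; first by move=> y yr; apply: Hr; rewrite inE yr orbT.
  by exists (k :: kap).
have Ep : p = \prod_(k <- kap) ('X - (lam k)%:P).
  by apply: (@map_poly_inj _ _ f); rewrite mp Er Ek big_map map_prod_XsubC.
have sz : size kap == n.
  by have := congr1 (fun q : {poly R} => size q) Ep;
    rewrite size_char_poly size_prod_XsubC => -[<-].
by exists (Tuple sz).
Qed.

(** * Smoothness of the eigenvalues *)

Section ImplicitRoot.
Context {R : realType}.

Lemma near_open (T : topologicalType) (P : T -> Prop) (x : T) :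
  (\forall y \near x, P y) -> exists U, [/\ open U, U x & forall y, U y -> P y].
Proof.
move=> Px; have : nbhs x P := Px.
by rewrite nbhsE => -[U [oU Ux] UP]; exists U.
Qed.

Lemma near_shift0 (V : normedModType R) (P : V -> Prop) (x : V) :
  (\forall y \near x, P y) -> \forall h \near (0 : V), P (h + x).
Proof.
by rewrite (near_shift 0 x) => Px; apply: filterS Px => h /=; rewrite subr0.
Qed.

(** The factor [H] need only be continuous, because the other one is already of
    the order of the increment. *)
Lemma differentiable_mul_zero (V : normedModType R) (N H : V -> R) (x : V) :
  differentiable N x -> N x = 0 -> {for x, continuous H} ->
  is_diff x (fun y => H y * N y) (fun v => H x * 'd N x v).
Proof.
move=> dN N0 cH.
have cdN := diff_continuous dN.
have [k k0 Hk] := linear_lipschitz cdN.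
pose L : {linear V -> R} := ( *:%R (H x)) \o 'd N x.
have cL : continuous L.
  by move=> v; apply: continuous_comp; [exact: cdN|exact: scaler_continuous].
have D : (fun y => H y * N y) \o shift x = cst (H x * N x) + L +o_ 0 id.
  apply/eqaddoP => e e0.
  pose d := e / 2 / (k + 1 + `|H x|).
  have c0 : 0 < k + 1 + `|H x| by rewrite ltr_wpDr // addr_gt0.
  have d0 : 0 < d by rewrite !divr_gt0.
  have /diff_locally /eqaddoP/(_ (Num.min 1 d)) := dN.
  rewrite lt_min ltr01 d0 => /(_ isT) HN.
  have HH : \forall h \near (0 : V), `|H (h + x) - H x| <= d.
    apply: (@near_shift0 _ (fun y => `|H y - H x| <= d)).
    by have /cvgrPdist_le/(_ d d0) := cH; apply: filterS => y; rewrite distrC.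
  near=> h.
  have hN : `|N (h + x) - 'd N x h| <= Num.min 1 d * `|h|.
    have : `|(N \o shift x - (cst (N x) + 'd N x)) h| <= Num.min 1 d * `|h| by near: h.
    by rewrite /= !fctE /= N0 add0r.
  have hH : `|H (h + x) - H x| <= d by near: h.
  have hN1 : `|N (h + x)| <= (k + 1) * `|h|.
    rewrite -[N _](subrK ('d N x h)) addrC mulrDl mul1r;
      apply: le_trans (ler_normD _ _) _.
    apply: lerD; first exact: Hk.
    by apply: le_trans hN _; rewrite ler_piMl // ge_min lexx.
  have hN2 : `|N (h + x) - 'd N x h| <= d * `|h|.
    by apply: le_trans hN _; rewrite ler_wpM2r // ge_min lexx orbT.
  rewrite /= !fctE /= N0 mulr0 add0r.
  rewrite -[_ *: _]/(H x * 'd N x h).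
  have -> : H (h + x) * N (h + x) - H x * 'd N x h =
    (H (h + x) - H x) * N (h + x) + H x * (N (h + x) - 'd N x h) by ring.
  apply: le_trans (ler_normD _ _) _; rewrite !normrM.
  apply: le_trans (_ : d * ((k + 1) * `|h|) + `|H x| * (d * `|h|) <= _).
    by apply: lerD; [apply: ler_pM|apply: ler_wpM2l].
  rewrite (_ : _ + _ = d * (k + 1 + `|H x|) * `|h|); last by ring.
  by rewrite /d divfK ?gt_eqF // ler_wpM2r //; lra.
have E := diff_unique cL D.
apply: DiffDef; last by rewrite E; apply/funext.
by apply/diff_locallyP; rewrite E.
Unshelve. all: by end_near. Qed.

(** The part of the implicit function theorem that remains when the root is
    already known to be continuous. *)
Section Root.
Variables (V : normedModType R) (U : set V) (N : nat) (c : nat -> V -> R) (l : V -> R).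
Hypothesis oU : open U.
Hypothesis c_smooth : forall i k, Ck_on k U (c i).
Hypothesis l_continuous : forall x, U x -> {for x, continuous l}.
Hypothesis l_root : forall x, U x -> \sum_(i < N) c i x * l x ^+ i = 0.
Let dF x := \sum_(i < N) c i x * (l x ^+ i.-1 *+ i).
Hypothesis l_simple : forall x, U x -> dF x != 0.

Let root_differentiable x : U x ->
  differentiable l x /\
  forall v, 'D_v l x = - (dF x)^-1 * \sum_(i < N) 'D_v (c i) x * l x ^+ i.
Proof.
move=> Ux.
have dc i : differentiable (c i) x by exact: (c_smooth i 1).1.
(* The polynomial with coefficients [c i y] takes the value 0 at [l y] and
     [Q y] at [l x]; [G y] is its divided difference between these points. *)
pose G y := \sum_(i < N) c i y * \sum_(j < i) l y ^+ (i.-1 - j) * l x ^+ j.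
pose Q y := \sum_(i < N) c i y * l x ^+ i.
have GQ y : U y -> Q y + (l y - l x) * G y = 0.
  move=> Uy; rewrite -(l_root Uy) /Q /G mulr_sumr -big_split /=; apply: eq_bigr => i _.
  have := subrXX (l y) (l x) i.
  rewrite mulrCA => E; rewrite (_ : (l y - l x) * _ = l y ^+ i - l x ^+ i); first by ring.
  by rewrite E; congr (_ * _); apply: eq_bigr => j _; rewrite subnS -subn1 subnAC subn1.
have Gx : G x = dF x.
  apply: eq_bigr => i _; congr (_ * _).
  rewrite (eq_bigr (fun=> l x ^+ i.-1)) ?sumr_const ?card_ord // => j _.
  by rewrite -exprD subnK //; case: (nat_of_ord i) j => [[]|k [j jk]].
have cl := l_continuous Ux.
have cont_sum n (f : 'I_n -> V -> R) : (forall i, {for x, continuous (f i)}) ->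
    {for x, continuous (fun y => \sum_i f i y)}.
  move=> cf; rewrite (_ : (fun y => _) = \sum_i f i); last by apply/funext => y;
    rewrite fct_sumE.
  elim/big_ind: _ => [|g h cg ch|i _];
    [exact: cst_continuous|exact: continuousD|exact: cf].
have cont_exp (m : nat) : {for x, continuous (fun y => l y ^+ m)}.
  elim: m => [|m IH]; first exact: cst_continuous.
  rewrite (_ : (fun y => _) = (fun y => l y * l y ^+ m)); last by apply/funext => y;
    rewrite exprS.
  exact: continuousM.
have cG : {for x, continuous G}.
  apply: (cont_sum) => i; apply: continuousM; first exact: differentiable_continuous.
  by apply: cont_sum => j; apply: continuousM; [exact: cont_exp|exact: cst_continuous].
have G0 : G x != 0 by rewrite Gx l_simple.
have Q0 : Q x = 0 by exact: l_root.
have dQi i : differentiable (fun y => c i y * l x ^+ i) x.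
  by apply: differentiableM => //; exact: differentiable_cst.
have QE : Q = \sum_(i < N) (fun y => c i y * l x ^+ i).
  by apply/funext => y; rewrite fct_sumE.
have dQ : differentiable Q x by rewrite QE; exact: differentiable_sum.
have cH : {for x, continuous (fun y => - (G y)^-1)} by apply/continuousN/continuousV.
have D := differentiable_mul_zero dQ Q0 cH.
have dHQ := is_diffD (is_diff_cst (l x) x) D.
have lE : \forall y \near x, (cst (l x) + (fun y => - (G y)^-1 * Q y)) y = l y.
  have nG : \forall y \near x, G y != 0.
    by apply: (cG [set t | t != 0]); exact: open_nbhs_nbhs (conj (@open_neq _ _) G0).
  near=> y; have Gy : G y != 0 by near: y.
  have Uy : U y by near: y; exact: open_nbhs_nbhs.
  have QG : Q y = - ((l y - l x) * G y) by apply/eqP; rewrite -addr_eq0 GQ.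
  by rewrite fctE /= QG mulrNN mulrCA mulVf // mulr1 addrC subrK.
have dl : differentiable (cst (l x) + (fun y => - (G y)^-1 * Q y)) x by exact:
  (@ex_diff _ _ _ _ _ _ _ dHQ).
split=> [|v]; first exact: near_eq_differentiable lE dl.
rewrite -(near_eq_derive v lE) deriveE // (@diff_val _ _ _ _ _ _ _ dHQ) fctE add0r -Gx;
  congr (_ * _).
rewrite -deriveE // QE derive_sum //; last by move=> i; exact: diff_derivable.
by apply: eq_bigr => i _; rewrite deriveMr //; [rewrite mulrC|exact: diff_derivable].
Unshelve. all: by end_near. Qed.

Lemma Ck_on_root k : Ck_on k U l.
Proof.
elim: k => [|k IH]; first exact: l_continuous.
split=> [x /root_differentiable[]//|v].
have Cexp (m : nat) : Ck_on k U (fun y => l y ^+ m).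
  elim: m => [|m IHm]; first exact: (Ck_on_cst k U (1 : R)).
  by apply: eq_Ck_on (Ck_onM oU IH IHm) => // x _; rewrite exprS.
have CdF : Ck_on k U dF.
  apply: Ck_on_sum => // i _; apply: Ck_onM => //.
  apply: eq_Ck_on (Ck_onM oU (Ck_on_cst k U (i%:R : R)) (Cexp i.-1)) => // x _.
  by rewrite mulr_natl.
have C : Ck_on k U (fun y => - (dF y)^-1 * \sum_(i < N) 'D_v (c i) y * l y ^+ i).
  apply: Ck_onM => //; first by apply: Ck_onN => //; apply: Ck_onV.
  by apply: Ck_on_sum => // i _; apply: Ck_onM => //; exact: (c_smooth i k.+1).2.
by apply: eq_Ck_on C => // x /root_differentiable[_ ->].
Qed.

End Root.
End ImplicitRoot.

Section Eigenvalues.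
Context {R : realType}.

(** A root of multiplicity [m.+1] becomes a simple root of the derivative of order
    [m], to which the implicit function argument applies. *)
Lemma derivn_multiple_root (p q : {poly R}) (a : R) (m : nat) :
  p = ('X - a%:P) ^+ m.+1 * q -> q.[a] != 0 ->
  root p^`(m) a /\ (p^`(m)^`()).[a] != 0.
Proof.
elim: m p q => [|m IH] p q -> qa.
  rewrite derivn0 expr1 rootM root_XsubC eqxx derivM derivXsubC mul1r; split=> //.
  by rewrite !hornerE subrr mul0r addr0.
rewrite derivSn; apply: (IH _ (q *+ m.+2 + ('X - a%:P) * q^`())).
  rewrite derivM deriv_exp derivXsubC mul1r mulrnAl exprS -mulrA.
  rewrite [in RHS]mulrDr -!mulrnAr [in RHS]mulrCA; congr (_ + _).
rewrite hornerD hornerMn hornerM hornerXsubC subrr mul0r addr0 -mulr_natr mulf_neq0 //.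
Qed.

Section CoefSmooth.
Variables (V : normedModType R) (U : set V) (k : nat).
Hypothesis oU : open U.

Lemma Ck_on_coef_prod (I : Type) (r : seq I) (P : pred I) (p : I -> V -> {poly R}) :
  (forall i j, P i -> Ck_on k U (fun x => (p i x)`_j)) ->
  forall j, Ck_on k U (fun x => (\prod_(i <- r | P i) p i x)`_j).
Proof.
move=> Cp; elim: r => [|i r IH] j.
  by apply: eq_Ck_on (Ck_on_cst k U (1%:P : {poly R})`_j) => // x _; rewrite big_nil.
case Pi: (P i); last by apply: eq_Ck_on (IH j) => // x _; rewrite big_cons Pi.
have := @Ck_on_sum R V U oU k R _ (index_enum 'I_j.+1) xpredT _
  (fun l _ => Ck_onM oU (Cp i l Pi) (IH (j - l)%N)).
by apply: eq_Ck_on => // x _; rewrite big_cons Pi coefM.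
Qed.

Lemma Ck_on_coef_char_poly n (A : V -> 'M[R]_n) : Ck_on k U A ->
  forall j, Ck_on k U (fun x => (char_poly (A x))`_j).
Proof.
move=> CA j.
apply: (@eq_Ck_on _ _ _ _ _ (fun x => \sum_(s : {perm 'I_n})
    (-1) ^+ s * (\prod_i (char_poly_mx (A x)) i (s i))`_j)) => //.
  move=> x _; rewrite /char_poly /determinant coef_sum; apply: eq_bigr => s _.
  by rewrite !mulr_sign; case: (odd_perm s); rewrite ?coefN.
apply: Ck_on_sum => // s _; apply: Ck_onM => //; first exact: Ck_on_cst.
apply: Ck_on_coef_prod => i l _.
apply: (@eq_Ck_on _ _ _ _ _ (fun x => ('X *+ (i == s i))`_l - (A x i (s i) *+ (l ==
  0%N)))) => //.
  by move=> x _; rewrite !mxE coefB coefC; case: (l == 0%N).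
apply: Ck_onD => //; first exact: Ck_on_cst.
apply: Ck_onN => //; case: (l == 0%N); last exact: (Ck_on_cst k U (0 : R)).
exact: (Ck_on_mxP oU _ _).1 CA i (s i).
Qed.

End CoefSmooth.

Section SmoothEigenvalues.
Variables (V : normedModType R) (U : set V) (n s : nat).
Variables (A : V -> 'M[R]_n) (lam : 'I_s -> V -> R).
Hypothesis oU : open U.
Hypothesis A_smooth : forall k, Ck_on k U A.
Hypothesis lam_continuous : forall j x, U x -> {for x, continuous (lam j)}.
Hypothesis lam_inj : forall x, U x -> injective (lam ^~ x).
Hypothesis char_poly_split : forall x, U x ->
  exists kappa : n.-tuple 'I_s, char_poly (A x) = \prod_(k <- kappa) ('X - (lam k x)%:P).
Hypothesis lam_root : forall j x, U x -> root (char_poly (A x)) (lam j x).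

(** The multiplicities are locally constant: there are finitely many ways of
    distributing them, and the coefficients of the characteristic polynomial
    exclude all but one near a given point. *)
Let split_locally_constant x0 : U x0 -> exists kappa : n.-tuple 'I_s,
  \forall x \near x0, U x /\ char_poly (A x) = \prod_(k <- kappa) ('X - (lam k x)%:P).
Proof.
move=> Ux0; have [kappa E0] := char_poly_split Ux0; exists kappa.
have near_neq (kap : n.-tuple 'I_s) : ~~ perm_eq kap kappa ->
    \forall x \near x0, char_poly (A x) != \prod_(k <- kap) ('X - (lam k x)%:P).
  move=> nperm.
  have [j] : exists j, (char_poly (A x0))`_j != (\prod_(k <- kap) ('X - (lam k
    x0)%:P))`_j.
    apply: contrapT => /forallNP H; move/negP: nperm; apply.
    suff : \prod_(a <- map (lam ^~ x0) kap) ('X - a%:P) = \prod_(a <- map (lam ^~ x0)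
      kappa) ('X - a%:P).
      by move=> /prod_XsubC_eq; apply: perm_map_inj; exact: lam_inj.
    rewrite !big_map -E0; apply/esym/polyP => j.
    by have := H j; move=> /negP; rewrite negbK => /eqP.
  have cl : {for x0, continuous (fun x => (char_poly (A x))`_j - (\prod_(k <- kap) ('X
    - (lam k x)%:P))`_j)}.
    apply: (@Ck_onD _ _ _ oU 0%N) => //; first exact: Ck_on_coef_char_poly (A_smooth 0) j.
    apply: Ck_onN => //; apply: Ck_on_coef_prod => // i l _.
    apply: (@eq_Ck_on _ _ _ _ _ (fun x => 'X`_l - (lam i x *+ (l == 0%N)))) => //.
      by move=> x _; rewrite coefB coefC; case: (l == 0%N).
    apply: Ck_onD => //; first exact: Ck_on_cst.
    apply: Ck_onN => //; case: (l == 0%N); last exact: (Ck_on_cst 0 U (0 : R)).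
    by move=> x Ux; exact: lam_continuous.
  rewrite -subr_eq0 => n0.
  have nz : \forall x \near x0, (char_poly (A x))`_j - (\prod_(k <- kap) ('X - (lam k
    x)%:P))`_j != 0.
    exact: cl [set t | t != 0] (open_nbhs_nbhs (conj (@open_neq _ _) n0)).
  apply: filterS nz => x /=; apply: contra_neq => ->; exact: subrr.
have : \forall x \near x0, forall kap : n.-tuple 'I_s, ~~ perm_eq kap kappa ->
    char_poly (A x) != \prod_(k <- kap) ('X - (lam k x)%:P).
  apply: (@filter_forall _ _ _ (nbhs x0)) => kap.
  case: (boolP (perm_eq kap kappa)) => [pk|/near_neq]; first by near=> x.
  by apply: filterS => x.
move=> H; near=> x.
have Ux : U x by near: x; exact: open_nbhs_nbhs.
split=> //; have [kap E] := char_poly_split Ux.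
have Hx : forall kap : n.-tuple 'I_s, ~~ perm_eq kap kappa ->
    char_poly (A x) != \prod_(k <- kap) ('X - (lam k x)%:P) by near: x.
rewrite {1}E; apply: perm_big; apply: contraT => /Hx.
by rewrite E eqxx.
Unshelve. all: by end_near. Qed.

(** Where the multiplicity [m.+1] of [lam j] is constant, [lam j] is a simple root
    of the derivative of order [m] of the characteristic polynomial, whose
    coefficients are smooth. *)
Lemma Ck_on_eigenvalue j k : Ck_on k U (lam j).
Proof.
apply: Ck_on_pointwise => x0 Ux0.
have [kappa /near_open[U' [oU' U'x0 HU']]] := split_locally_constant Ux0.
exists U' => //.
have sU : U' `<=` U by move=> x /HU'[].
have jk : j \in kappa.
  have := lam_root j Ux0; rewrite (HU' _ U'x0).2.
  rewrite -(big_map (lam ^~ x0) xpredT (fun a => 'X - a%:P)) root_prod_XsubC.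
  by rewrite mem_map //; exact: lam_inj.
pose m := (count_mem j kappa).-1.
have mE : count_mem j kappa = m.+1 by rewrite prednK // -has_count has_pred1.
pose c i x := (char_poly (A x))^`(m)`_i.
have Hm x : U' x -> root (char_poly (A x))^`(m) (lam j x) /\
    ((char_poly (A x))^`(m)^`()).[lam j x] != 0.
  move=> U'x; apply: (@derivn_multiple_root _
      (\prod_(k <- kappa | k != j) ('X - (lam k x)%:P))).
    rewrite (HU' _ U'x).2 (bigID (pred1 j)) /=; congr (_ * _).
    rewrite (eq_bigr (fun=> 'X - (lam j x)%:P)) => [|i /eqP->//].
    by rewrite big_const_seq mE iter_mulr_1.
  rewrite horner_prod prodf_seq_neq0; apply/allP => i _; apply/implyP => ij.
  by rewrite hornerXsubC subr_eq0 eq_sym; apply: contra_neq ij;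
    exact: lam_inj (sU _ U'x) _ _.
have szp x : (size (char_poly (A x))^`(m) <= n.+1)%N.
  apply/leq_sizeP => i ni; rewrite coef_derivn nth_default ?mul0rn // size_char_poly.
  exact: leq_trans ni (leq_addl _ _).
apply: (@Ck_on_root R V U' n.+1 c) => //.
- move=> i k'.
  apply: (@eq_Ck_on _ _ _ _ _ (fun x => (char_poly (A x))`_(m + i) *+ (m + i) ^_ m)) =>
    //.
    by move=> x _; rewrite /c coef_derivn.
  apply: (@eq_Ck_on _ _ _ _ _ (fun x => ((m + i) ^_ m)%:R * (char_poly (A x))`_(m +
    i))) => //.
    by move=> x _; rewrite mulr_natl.
  apply: Ck_onM => //; first exact: Ck_on_cst.
  by apply: Ck_on_coef_char_poly => //; exact: Ck_on_subset (A_smooth k').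
- by move=> x /sU; exact: lam_continuous.
- by move=> x /Hm[/rootP + _]; rewrite (horner_coef_wide _ (szp x)).
- move=> x /Hm[_]; apply: contra_neq => E.
  rewrite -E (@horner_coef_wide _ n.+1); last first.
    apply/leq_sizeP => i ni; rewrite coef_deriv nth_default ?mul0rn //.
    exact: leq_trans (szp x) (leqW ni).
  rewrite [RHS]big_ord_recl mulr0n mulr0 add0r [LHS]big_ord_recr /= [X in _ + X](_ : _
    = 0).
    rewrite addr0; apply: eq_bigr => i _.
    by rewrite coef_deriv /c /bump /= add1n mulrnAl mulrnAr.
  by rewrite coef_deriv nth_default ?mul0rn ?mul0r.
Qed.

End SmoothEigenvalues.
End Eigenvalues.

(** * The torsion on a sum of generalized eigenspaces *)

Section TorsionAlgebra.
Variables (F : fieldType) (n s : nat) (A : 'M[F]_n) (lam : 'I_s -> F).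
Variables (kappa : n.-tuple 'I_s) (S : {set 'I_s}).
Hypothesis lam_inj : injective lam.
Hypothesis char_polyA : char_poly A = \prod_(k <- kappa) ('X - (lam k)%:P).
Let P := spectral_mx A lam S.
Implicit Types (xi eta : 'rV[F]_n) (beta : 'rV[F]_n -> 'rV[F]_n -> 'rV[F]_n).

Let AP : A *m P = P *m A.
Proof. by have [] := spectral_mxP lam_inj char_polyA S. Qed.

Let kerA xi : xi *m P = 0 -> xi *m A *m P = 0.
Proof. by move=> xP; rewrite -mulmxA AP mulmxA xP mul0mx. Qed.

(** On [ker P] the polynomial whose value at [A] is [P] annihilates [A], whereas
    it is invertible on the image of [P]; hence no nonzero map between these
    spaces commutes with [A]. *)
Lemma spectral_intertwiner_eq0 (gamma : 'rV[F]_n -> 'rV[F]_n) :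
  (forall a x y, gamma (a *: x + y) = a *: gamma x + gamma y) ->
  (forall xi, xi *m P = 0 -> gamma (xi *m A) = gamma xi *m A) ->
  (forall xi, xi *m P = 0 -> (gamma xi <= P)%MS) ->
  forall xi, xi *m P = 0 -> gamma xi = 0.
Proof.
move=> lin gA gP xi xP.
have g0 : gamma 0 = 0.
  by have := lin (-1) 0 0; rewrite scaler0 addr0 scaleN1r addNr.
pose good (Z : 'M[F]_n) := forall x, x *m P = 0 ->
  x *m Z *m P = 0 /\ gamma (x *m Z) = gamma x *m Z.
have good1 : good 1%:M by move=> x xP0; rewrite !mulmx1.
have goodM Z Z' : good Z -> good Z' -> good (Z *m Z').
  move=> gZ gZ' x /gZ[xZ E]; rewrite !mulmxA.
  by have [-> ->] := gZ' _ xZ; rewrite E.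
have goodA k : good (A - (lam k)%:M).
  move=> x xP0; rewrite !mulmxBr !mul_mx_scalar mulmxBl kerA // -scalemxAl xP0.
  rewrite scaler0 subr0; split=> //.
  by rewrite addrC -scaleNr lin gA // scaleNr addrC.
have goodX k m : good ((A - (lam k)%:M) ^+ m).
  by elim: m => [|m IH]; [exact: good1|rewrite exprS; exact: goodM].
have goodP : good P by apply: big_ind => [|Z Z'|k _];
  [exact: good1|exact: goodM|exact: goodX].
have [_] := goodP xi xP; rewrite xP g0 => /esym.
have /submxP[z ->] := gP xi xP.
exact: (spectral_mx_sqr lam_inj char_polyA).
Qed.

Definition torsion_step beta xi eta : 'rV[F]_n :=
  beta xi eta *m A *m A + beta (xi *m A) (eta *m A)
  - (beta xi (eta *m A) + beta (xi *m A) eta) *m A.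

Let transverse beta :=
  [/\ forall eta a x y, beta (a *: x + y) eta = a *: beta x eta + beta y eta,
      forall xi a x y, beta xi (a *: x + y) = a *: beta xi x + beta xi y &
      forall xi eta, xi *m P = 0 -> eta *m P = 0 -> (beta xi eta <= P)%MS].

Let subA p (B : 'M[F]_(p, n)) : (B <= P)%MS -> (B *m A <= P)%MS.
Proof. by move=> /submxP[z ->]; rewrite -mulmxA -AP mulmxA submxMl. Qed.

Let transverse_step beta : transverse beta -> transverse (torsion_step beta).
Proof.
move=> [l1 l2 bP]; split.
- move=> eta a x y; rewrite /torsion_step mulmxDl -scalemxAl !l1 !mulmxDl -!scalemxAl.
  by apply/rowP => j; rewrite !mxE; ring.
- move=> xi a x y; rewrite /torsion_step mulmxDl -scalemxAl !l2 !mulmxDl -!scalemxAl.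
  by apply/rowP => j; rewrite !mxE; ring.
- move=> xi eta xP eP; rewrite /torsion_step.
  rewrite addmx_sub ?eqmx_opp ?subA ?addmx_sub ?subA // ?bP ?kerA //.
Qed.

(** The step factors as [(L - P1) (L - P2)], where [L] is [A] acting on the
    values and [P1], [P2] are [A] acting on the arguments; both factors are
    injective by [spectral_intertwiner_eq0]. *)
Let torsion_step_inj beta : transverse beta ->
  (forall xi eta, xi *m P = 0 -> eta *m P = 0 -> torsion_step beta xi eta = 0) ->
  forall xi eta, xi *m P = 0 -> eta *m P = 0 -> beta xi eta = 0.
Proof.
move=> [l1 l2 bP] T0 xi eta xP eP.
have step1 x e : x *m P = 0 -> e *m P = 0 -> beta x (e *m A) = beta x e *m A.
  move=> xP0 eP0; apply/eqP; rewrite -subr_eq0; apply/eqP.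
  apply: (@spectral_intertwiner_eq0 (fun x => beta x (e *m A) - beta x e *m A)) => //.
  - move=> a y z; rewrite !l1 mulmxDl -scalemxAl.
    by apply/rowP => j; rewrite !mxE; ring.
  - move=> y yP; have := T0 y e yP eP0; rewrite /torsion_step mulmxDl mulmxBl => E.
    apply/eqP; rewrite -subr_eq0 -E; apply/eqP.
    by apply/rowP => j; rewrite !mxE; ring.
  - by move=> y yP; rewrite addmx_sub ?eqmx_opp ?subA // bP ?kerA.
apply: (@spectral_intertwiner_eq0 (beta xi)) => //.
- by move=> e eP0; exact: step1.
- by move=> e eP0; exact: bP.
Qed.

Lemma iter_torsion_step_inj m beta :
  (forall eta a x y, beta (a *: x + y) eta = a *: beta x eta + beta y eta) ->
  (forall xi a x y, beta xi (a *: x + y) = a *: beta xi x + beta xi y) ->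
  (forall xi eta, xi *m P = 0 -> eta *m P = 0 -> (beta xi eta <= P)%MS) ->
  (forall xi eta, xi *m P = 0 -> eta *m P = 0 -> iter m torsion_step beta xi eta = 0) ->
  forall xi eta, xi *m P = 0 -> eta *m P = 0 -> beta xi eta = 0.
Proof.
move=> l1 l2 bP; have tb : transverse beta by [].
elim: m => // m IH T0; apply: IH; apply: torsion_step_inj => //.
by elim: m {T0} => // m; exact: transverse_step.
Qed.

End TorsionAlgebra.

Section TorsionInChart.
Variables (R : realType) (n : nat) (M : smooth_manifold R n).
Variables (A : chart M -> M -> 'M[R]_n) (i : chart M) (x : M).
Variable (P : 'rV[R]_n -> 'M[R]_n).
Hypothesis dom_x : dom i x.
Let u0 := coord i x.
Hypothesis dA : differentiable (fun u => A i (param i u)) u0.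
Hypothesis dP : differentiable P u0.
Hypothesis AP : \forall u \near u0, A i (param i u) *m P u = P u *m A i (param i u).

(** The image under [P] of the Lie bracket of two vector fields annihilated by
    [P], once the Leibniz rule has moved the derivatives of the fields onto [P]: it
    depends on the values of the fields at the point only. *)
Definition bracket_defect (xi eta : 'rV[R]_n) : 'rV[R]_n :=
  xi *m 'D_eta P u0 - eta *m 'D_xi P u0.

Let derive_linear_direction (a : R) (v w : 'rV[R]_n) :
  'D_(a *: v + w) P u0 = a *: 'D_v P u0 + 'D_w P u0.
Proof. by rewrite !deriveE // linearP. Qed.

Lemma bracket_defect_linearl eta (a : R) (v w : 'rV[R]_n) :
  bracket_defect (a *: v + w) eta = a *: bracket_defect v eta + bracket_defect w eta.
Proof.
rewrite /bracket_defect derive_linear_direction mulmxDl mulmxDr -scalemxAl -scalemxAr.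
by rewrite scalerBr opprD addrACA.
Qed.

Lemma bracket_defect_linearr xi (a : R) (v w : 'rV[R]_n) :
  bracket_defect xi (a *: v + w) = a *: bracket_defect xi v + bracket_defect xi w.
Proof.
rewrite /bracket_defect derive_linear_direction mulmxDl mulmxDr -scalemxAl -scalemxAr.
by rewrite scalerBr opprD addrACA.
Qed.

Let is_section (X : chart M -> M -> 'rV[R]_n) :=
  differentiable (fun u => X i (param i u)) u0 /\
  \forall u \near u0, X i (param i u) *m P u = 0.

Let section_leibniz X v : is_section X ->
  'D_v (fun u => X i (param i u)) u0 *m P u0 = - (X i x *m 'D_v P u0).
Proof.
move=> [dX XP].
have := derive_mulmx v dX dP; rewrite (near_eq_derive (g := cst 0)) //.
rewrite derive_cst /u0 coordK // => /eqP; rewrite eq_sym addr_eq0 => /eqP.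
by [].
Qed.

Let section_op X : is_section X -> is_section (op_apply A X).
Proof.
move=> [dX XP]; split.
  apply/differentiable_mxP => a b.
  rewrite (_ : (fun u => _) = \sum_l (fun u => X i (param i u) a l * A i (param i u) l
    b)).
    apply: differentiable_sum => l; apply: differentiableM.
      exact: (differentiable_mxP _ _).1 dX a l.
    exact: (differentiable_mxP _ _).1 dA l b.
  by apply/funext => u; rewrite fct_sumE /op_apply mxE.
near=> u; rewrite /op_apply -mulmxA.
have -> : A i (param i u) *m P u = P u *m A i (param i u) by near: u.
have XPu : X i (param i u) *m P u = 0 by near: u.
by rewrite mulmxA XPu mul0mx.
Unshelve. all: by end_near. Qed.

(** The sections annihilated by [P] are stable under [A], and [P] commutes with
    [A]; hence the recursion that defines the torsion passes to the defect. *)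
Lemma torsion_bracket_defect m X Y :
  differentiable (fun u => X i (param i u)) u0 ->
  (\forall u \near u0, X i (param i u) *m P u = 0) ->
  differentiable (fun u => Y i (param i u)) u0 ->
  (\forall u \near u0, Y i (param i u) *m P u = 0) ->
  torsion m A X Y i x *m P u0 =
  iter m (torsion_step (A i x)) bracket_defect (X i x) (Y i x).
Proof.
move=> dX XP dY YP.
have sX : is_section X by [].
have sY : is_section Y by [].
move: X Y sX sY {dX XP dY YP}.
have APx : A i x *m P u0 = P u0 *m A i x.
  by have := nbhs_singleton AP; rewrite /u0 coordK.
elim: m => [|m IH] X Y sX sY /=.
  rewrite /lie_bracket mulmxBl (section_leibniz _ sY) (section_leibniz _ sX).
  by rewrite opprK addrC.
have sAX := section_op sX; have sAY := section_op sY.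
rewrite /torsion_step /op_apply !(mulmxBl, mulmxDl) -!mulmxA !APx !(mulmxA _ (P u0)).
rewrite -!IH // -/(op_apply A X i x) -/(op_apply A Y i x) -!IH //.
by rewrite APx !mulmxA.
Qed.

End TorsionInChart.

(** * Vector fields supported in a chart *)

Section Charts.
Context {R : realType} {n : nat} (M : smooth_manifold R n).
Implicit Types (i j k : chart M) (x : M).

Definition chart_image i : set 'rV[R]_n := coord i @` dom i.
Definition chart_overlap i j : set 'rV[R]_n := coord i @` (dom i `&` dom j).

Lemma paramK i u : chart_image i u -> coord i (param i u) = u /\ dom i (param i u).
Proof. by move=> [x dx <-]; rewrite coordK. Qed.

Lemma chart_image_coord i x : dom i x -> chart_image i (coord i x).
Proof. by exists x. Qed.

Lemma chart_overlap_coord i j x : dom i x -> dom j x -> chart_overlap i j (coord i x).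
Proof. by exists x. Qed.

Lemma chart_overlapP i j u :
  chart_overlap i j u <-> chart_image i u /\ dom j (param i u).
Proof.
split=> [[x [dx dx'] <-]|[[x dx <-]]]; first by split; [exists x|rewrite coordK].
by rewrite coordK // => dx'; exists x.
Qed.

(** The part of a chart that is mapped to an open set is open, although [param]
    is continuous on the image of the chart only. *)
Lemma chart_preimage_open i (O : set M) : open O ->
  open [set u | chart_image i u /\ O (param i u)].
Proof.
move=> oO; rewrite openE => u [iu Ou].
have h1 : \forall v \near u, chart_image i v.
  by apply: open_nbhs_nbhs; split; [exact: coord_open|].
have h2 : \forall v \near u, O (param i v).
  exact: (param_continuous iu) (open_nbhs_nbhs (conj oO Ou)).
by apply: filterS2 h1 h2 => v; split.
Qed.

Lemma chart_overlap_open i j : open (chart_overlap i j).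
Proof.
have := @chart_preimage_open i _ (@dom_open _ _ M j).
by congr open; apply/seteqP; split=> u; rewrite /= chart_overlapP.
Qed.

Arguments chart_overlap_open : clear implicits.

Lemma transition_differentiable i j x : dom i x -> dom j x ->
  differentiable (coord j \o param i) (coord i x).
Proof. by move=> dx dx';
  exact: (transition_smooth i j 1).1 (chart_overlap_coord dx dx'). Qed.

Lemma mul_jacobian m p (f : 'rV[R]_m -> 'rV[R]_p) u (v : 'rV[R]_m) :
  differentiable f u -> v *m jacobian f u = 'D_v f u.
Proof. by move=> df; rewrite deriveEjacobian. Qed.

Lemma jacobian_comp m p q (f : 'rV[R]_m -> 'rV[R]_p) (g : 'rV[R]_p -> 'rV[R]_q) u :
  differentiable f u -> differentiable g (f u) ->
  jacobian (g \o f) u = jacobian f u *m jacobian g (f u).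
Proof.
move=> df dg; have dgf := differentiable_comp df dg.
apply/row_matrixP => r; rewrite !rowE mulmxA !mul_jacobian //.
by rewrite !deriveE // (diff_comp df dg).
Qed.

Lemma near_eq_jacobian m p (f g : 'rV[R]_m -> 'rV[R]_p) u :
  (\forall v \near u, f v = g v) -> differentiable f u ->
  jacobian f u = jacobian g u.
Proof.
move=> fg df; have dg := near_eq_differentiable fg df.
apply/row_matrixP => r.
have rowJ h : differentiable h u -> row r (jacobian h u) = 'D_('e_r) h u.
  by move=> dh; rewrite rowE mul_jacobian.
transitivity ('D_('e_r) f u); first exact: rowJ.
transitivity ('D_('e_r) g u); first exact: near_eq_derive.
by apply/esym; exact: rowJ.
Qed.

Lemma transition_jacobian_id i x : dom i x -> transition_jacobian i i x = 1%:M.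
Proof.
move=> dx; have dt := transition_differentiable dx dx.
rewrite /transition_jacobian (@near_eq_jacobian _ _ _ id) //; last first.
  have : \forall v \near coord i x, chart_image i v.
    by apply: open_nbhs_nbhs; split; [exact: coord_open|exact: chart_image_coord].
  by apply: filterS => v /paramK[].
apply/row_matrixP => r; rewrite !rowE mulmx1 mul_jacobian ?derive_id //.
Qed.

Lemma transition_jacobian_comp i j k x : dom i x -> dom j x -> dom k x ->
  transition_jacobian i k x = transition_jacobian i j x *m transition_jacobian j k x.
Proof.
move=> di dj dk.
have dij := transition_differentiable di dj.
have djk := transition_differentiable dj dk.
have dik := transition_differentiable di dk.
have Ex : (coord j \o param i) (coord i x) = coord j x by rewrite /= coordK.
have djk' : differentiable (coord k \o param j) ((coord j \o param i) (coord i x)).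
  by rewrite Ex.
have E := jacobian_comp dij djk'; rewrite Ex in E.
transitivity (jacobian ((coord k \o param j) \o (coord j \o param i)) (coord i x));
  last exact: E.
apply: near_eq_jacobian => //.
have : \forall v \near coord i x, chart_overlap i j v.
  by apply: open_nbhs_nbhs; split; [exact: chart_overlap_open|exact: chart_overlap_coord].
by apply: filterS => v /chart_overlapP[iv jv] /=; rewrite coordK.
Qed.

Lemma Ck_on_jacobian (k : nat) i j :
  Ck_on k (chart_overlap i j) (jacobian (coord j \o param i)).
Proof.
have oU := chart_overlap_open i j.
apply/(Ck_on_mxP oU) => a b.
have := (Ck_on_mxP oU _ _).1 ((transition_smooth i j k.+1).2 (delta_mx 0 a)) 0 b.
apply: eq_Ck_on => // u Uu.
rewrite -mul_jacobian ?mul_delta_mx_cond -?rowE ?mxE //.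
exact: (transition_smooth i j 1).1.
Qed.

Definition field_of_chart i (W : 'rV[R]_n -> 'rV[R]_n) : chart M -> M -> 'rV[R]_n :=
  fun j x => if `[< dom i x >] then W (coord i x) *m transition_jacobian i j x else 0.

Lemma field_of_chartE i W x : dom i x -> field_of_chart i W i x = W (coord i x).
Proof.
by move=> dx; rewrite /field_of_chart asboolT // transition_jacobian_id // mulmx1.
Qed.

(** A smooth map with compact support in the image of a chart extends by zero to
    a smooth vector field; the support is closed because the manifold is
    Hausdorff. *)
Lemma vector_field_of_chart i (W : 'rV[R]_n -> 'rV[R]_n) (p : 'rV[R]_n) (r : R) :
  smooth_on setT W ->
  (forall u, `|u - p| <= r -> chart_image i u) ->
  (forall u, r <= `|u - p| -> W u = 0) ->
  vector_field (field_of_chart i W).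
Proof.
move=> sW ball_i W0; split=> [j k x dj dk|j k].
  rewrite /field_of_chart; case: asboolP => di; last by rewrite mul0mx.
  by rewrite (transition_jacobian_comp di dj dk) mulmxA.
pose K := param i @` [set u | `|u - p| <= r].
have cK : closed K.
  apply: compact_closed; first exact: carrier_hausdorff.
  apply: continuous_compact.
    apply: continuous_in_subspaceT => u; rewrite inE /= => /ball_i iu.
    exact: param_continuous.
  apply: bounded_closed_compact.
    exists (`|p| + r); split; first exact: num_real.
    move=> t tr u /= ur; apply/ltW/le_lt_trans/tr.
    rewrite -[u](subrK p) addrC; apply: le_trans (ler_normD _ _) _.
    by rewrite lerD2l.
  rewrite (_ : [set u | _] = (fun u => `|u - p|) @^-1` [set t | t <= r]) //.
  apply: closed_comp; last exact: closed_le.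
  move=> u _; apply: continuous_comp; last exact: norm_continuous.
  by apply: continuousB; [exact: cvg_id|exact: cst_continuous].
apply: Ck_on_local => u [x dj <-].
have [di|di] := pselect (dom i x).
  exists (chart_overlap j i),
    (fun v => W (coord i (param j v)) *m jacobian (coord j \o param i) (coord i (param
      j v))).
  have oji := chart_overlap_open j i.
  have CT : Ck_on k (chart_overlap j i) (coord i \o param j) by exact: transition_smooth.
  split=> //; first exact: chart_overlap_coord.
    apply: (Ck_on_mulmx oji).
      exact: (@Ck_on_comp_mx _ _ _ _ _ _ _ setT _ _ oji openT (fun _ _ => I) CT (sW k)).
    apply: (@Ck_on_comp_mx _ _ _ _ _ _ _ _ _ _ oji (chart_overlap_open i j) _ CT
      (Ck_on_jacobian k i j)).
    by move=> v /chart_overlapP[jv iv] /=; apply: chart_overlap_coord => //;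
      have [] := paramK jv.
  move=> v /chart_overlapP[jv iv].
  by rewrite /field_of_chart asboolT.
exists [set v | chart_image j v /\ (~` K) (param j v)], (fun=> 0); split.
- by apply: chart_preimage_open; exact: closed_openC.
- split; first exact: chart_image_coord.
  by rewrite coordK // => -[v vr E]; apply: di; rewrite -E;
    have [] := paramK (ball_i v vr).
- exact: Ck_on_cst.
- move=> v [jv nK]; rewrite /field_of_chart; case: asboolP => // iv.
  rewrite W0 ?mul0mx //; apply: ltW; rewrite ltNge; apply/negP => vr.
  by apply: nK; exists (coord i (param j v)) => //; rewrite coordK.
Qed.

End Charts.

(** * Integrability *)

Lemma closed_ball_in_open (R : realType) (V : normedModType R) (O : set V) (p : V) :
  open O -> O p -> exists r : R, 0 < r /\ forall u, `|u - p| <= r -> O u.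
Proof.
move=> oO Op; have /nbhs_ballP[e /= e0 He] := open_nbhs_nbhs (conj oO Op).
exists (e / 2); split=> [|u ur]; first exact: divr_gt0.
apply: He; rewrite -ball_normE /= distrC; apply: le_lt_trans ur _.
by rewrite ltr_pdivrMr // mulr_natr mulr2n ltrDl.
Qed.

Section SpectralSmooth.
Context {R : realType} {V : normedModType R} (U : set V) (k : nat).
Hypothesis oU : open U.

Lemma Ck_on_prod_mx n (I : Type) (r : seq I) (P : pred I) (f : I -> V -> 'M[R]_n) :
  (forall i, P i -> Ck_on k U (f i)) -> Ck_on k U (fun x => \prod_(i <- r | P i) f i x).
Proof.
move=> Cf; elim: r => [|i r IH].
  by apply: eq_Ck_on (Ck_on_cst k U (1 : 'M[R]_n)) => // x _; rewrite big_nil.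
case Pi: (P i); last by apply: eq_Ck_on IH => // x _; rewrite big_cons Pi.
by apply: eq_Ck_on (Ck_on_mulmx oU (Cf i Pi) IH) => // x _; rewrite big_cons Pi.
Qed.

Lemma Ck_on_spectral_mx n s (A : V -> 'M[R]_n) (lam : 'I_s -> V -> R) (S : {set 'I_s}) :
  Ck_on k U A -> (forall j, Ck_on k U (lam j)) ->
  Ck_on k U (fun x => spectral_mx (A x) (lam ^~ x) S).
Proof.
move=> CA Clam; apply: Ck_on_prod_mx => j _.
have C1 : Ck_on k U (fun x => A x - (lam j x)%:M).
  by apply: Ck_onD => //; apply: Ck_onN => //; exact: Ck_on_scalar_mx.
have Cpow (m : nat) : Ck_on k U (fun x => (A x - (lam j x)%:M) ^+ m).
  elim: m => [|m IH]; first exact: (Ck_on_cst k U (1 : 'M[R]_n)).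
  by apply: eq_Ck_on (Ck_on_mulmx oU C1 IH) => // x _; rewrite exprS.
exact: Cpow.
Qed.

End SpectralSmooth.

Lemma spectral_mx_conj (F : fieldType) n s (A B J : 'M[F]_n) (lam : 'I_s -> F) (S :
  {set 'I_s}) :
  A *m J = J *m B -> spectral_mx A lam S *m J = J *m spectral_mx B lam S.
Proof.
move=> AJ; rewrite /spectral_mx.
apply: (big_ind2 (fun X Y : 'M[F]_n => X *m J = J *m Y)).
- by rewrite mul1mx mulmx1.
- by move=> X X' Y Y' E E'; rewrite -mulmxA E' !mulmxA E.
- move=> k _; set X := A - _; set Y := B - _.
  have XY : X *m J = J *m Y by rewrite mulmxBl mulmxBr AJ scalar_mxC.
  suff pw q : X ^+ q *m J = J *m Y ^+ q by exact: pw.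
  elim: q => [|q IH]; first by rewrite mul1mx mulmx1.
  by rewrite !exprS -!mulmxE -mulmxA IH !mulmxA XY.
Qed.

Section Integrability.
Variables (R : realType) (n : nat) (M : smooth_manifold R n).
Variables (A : chart M -> M -> 'M[R]_n) (s : nat) (lam : 'I_s -> M -> R) (rho : 'I_s ->
  M -> nat).
Hypothesis A_op : operator_field A.
Hypothesis lam_continuous : forall k, continuous (lam k).
Hypothesis lam_distinct : forall x : M, injective (fun k => lam k x).
Hypothesis lam_spectrum : forall (i : chart M) (x : M), dom i x ->
  forall z : complex R, eigenvalue (map_mx (real_complex R) (A i x)) z
    <-> exists k : 'I_s, z = real_complex R (lam k x).
Hypothesis rho_riesz : forall (k : 'I_s) (i : chart M) (x : M), dom i x ->
  riesz_index (A i x - (lam k x)%:M) (rho k x).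
Hypothesis eigen_constant_rank : forall k : 'I_s,
  constant_rank (eigen_distribution A (lam k) (rho k)).
Variable m : nat.
Hypothesis torsion_eq0 : forall X Y : chart M -> M -> 'rV[R]_n,
  vector_field X -> vector_field Y ->
  forall (i : chart M) (x : M), dom i x -> torsion m A X Y i x = 0.

Let spectral (S : {set 'I_s}) (i : chart M) (x : M) := spectral_mx (A i x) (lam ^~ x) S.

Let split i x : dom i x -> exists kappa : n.-tuple 'I_s,
  char_poly (A i x) = \prod_(k <- kappa) ('X - (lam k x)%:P).
Proof. by move=> dx; apply: char_poly_real_split; exact: lam_spectrum. Qed.

Let spectral_smooth k S i : Ck_on k (chart_image i) (fun u => spectral S i (param i u)).
Proof.
have oU : open (chart_image i) by exact: coord_open.
apply: Ck_on_spectral_mx => // [|j]; first exact: A_op.2.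
apply: (@Ck_on_eigenvalue _ _ _ n s (fun u => A i (param i u)) (fun k u => lam k (param
  i u))) => //.
- by move=> k'; exact: A_op.2.
- move=> k' u iu; apply: continuous_comp; last exact: lam_continuous.
  exact: param_continuous.
- by move=> u iu; apply: split; have [] := paramK iu.
- move=> k' u iu; have [_ du] := paramK iu.
  have : eigenvalue (map_mx (real_complex R) (A i (param i u))) (real_complex R (lam k'
    (param i u))).
    by apply/(lam_spectrum du); exists k'.
  by rewrite eigenvalue_root_char -map_char_poly fmorph_root.
Qed.

Let eigen_geigenspace k i x : dom i x ->
  (eigen_distribution A (lam k) (rho k) i x :=: geigenspace (A i x) (lam k x))%MS.
Proof.
move=> dx; have [st rmin] := rho_riesz k dx.
exact: eqmx_trans (riesz_index_kermx st rmin) (eqmx_sym (geigenspace_kermx _ _)).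
Qed.

Let distribution_spectral (S : {set 'I_s}) i x : dom i x ->
  (\sum_(k in S) eigen_distribution A (lam k) (rho k) i x :=: spectral (~: S) i x)%MS.
Proof.
move=> dx; have [kappa E] := split dx.
apply: eqmx_trans (eqmx_sym (spectral_mx_geigenspace (lam_distinct (x := x)) E S)).
by apply: eqmx_sums => k _; exact: eigen_geigenspace.
Qed.

Let rank_constant (S : {set 'I_s}) : exists r, forall i x, dom i x ->
  \rank (spectral (~: S) i x) = r.
Proof.
have [r Hr] := choice eigen_constant_rank.
exists (\sum_(k in S) r k)%N => i x dx; have [kappa E] := split dx.
rewrite (rank_spectral_mx (lam_distinct (x := x)) E); apply: eq_bigr => k _.
by rewrite -(eigen_geigenspace k dx); exact: Hr.
Qed.

(** The bracket of two sections of the distribution is computed, modulo the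
    distribution, by [bracket_defect]; every pair of tangent vectors is extended
    to global sections, to which the hypothesis on the torsion applies. *)
Let involutive (S : {set 'I_s}) i x (xi eta : 'rV[R]_n) : dom i x ->
  xi *m spectral S i x = 0 -> eta *m spectral S i x = 0 ->
  bracket_defect i x (fun u => spectral S i (param i u)) xi eta = 0.
Proof.
move=> dx.
have oU : open (chart_image i) by exact: coord_open.
have Ux : chart_image i (coord i x) by exact: chart_image_coord.
have nU : \forall u \near coord i x, chart_image i u by exact: open_nbhs_nbhs.
pose P u := spectral S i (param i u); pose Q u := spectral (~: S) i (param i u).
have Px : P (coord i x) = spectral S i x by rewrite /P coordK.
have Qx : Q (coord i x) = spectral (~: S) i x by rewrite /Q coordK.
have [kappa E] := split dx; have inj := lam_distinct (x := x).
have dA : differentiable (fun u => A i (param i u)) (coord i x) by exact: (A_op.2 i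
  1%N).1.
have dP : differentiable P (coord i x) by exact: (spectral_smooth 1 S i).1.
have AP : \forall u \near coord i x, A i (param i u) *m P u = P u *m A i (param i u).
  apply: filterS nU => u iu; have [_ du] := paramK iu; have [kap Eu] := split du.
  by have [] := spectral_mxP (lam_distinct (x := param i u)) Eu S.
have [r [r0 ball_r]] := closed_ball_in_open oU Ux.
have ext (v : 'rV[R]_n) : v *m spectral S i x = 0 -> exists X, [/\ vector_field X, X i
  x = v,
    differentiable (fun u => X i (param i u)) (coord i x) &
    \forall u \near coord i x, X i (param i u) *m P u = 0].
  move=> /eqP; rewrite (spectral_mx_ker inj E) => /submxP[a va].
  pose b := bump_fun (coord i x) r.
  have b0 : b (coord i x) != 0 by rewrite gt_eqF // bump_fun_gt0.
  pose W u := (b u / b (coord i x)) *: (a *m Q u).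
  have CW k : Ck_on k (chart_image i) W.
    apply: (Ck_on_scalemx oU); last by apply: (Ck_on_mulmx oU (Ck_on_cst k _ a));
      exact: spectral_smooth.
    apply: (Ck_onM oU); last exact: Ck_on_cst.
    exact: Ck_on_subset (Ck_on_bump_fun k (coord i x) r).
  have W0 u : r <= `|u - coord i x| -> W u = 0.
    by move=> ur; rewrite /W /b bump_fun_eq0 // mul0r scale0r.
  have sW : smooth_on setT W.
    move=> k; apply: Ck_on_local => u _.
    have [ur|ur] := leP `|u - coord i x| r; first by exists (chart_image i), W;
      split=> //; exact: ball_r.
    exists [set v | r < `|v - coord i x|], (fun=> 0); split=> //.
    - rewrite (_ : [set v | _] = (fun v => `|v - coord i x|) @^-1` [set t | r < t]) //.
      apply: open_comp; last exact: open_gt.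
      move=> w _; apply: continuous_comp; last exact: norm_continuous.
      by apply: continuousB; [exact: cvg_id|exact: cst_continuous].
    - exact: Ck_on_cst.
    - by move=> w /= wr; rewrite W0 // ltW.
  have vf := vector_field_of_chart sW ball_r W0.
  exists (field_of_chart i W); split=> //.
  - by rewrite field_of_chartE // /W divff // scale1r va Qx.
  - by apply: (vf.2 i 1%N).1.
  - apply: filterS nU => u iu; have [uK du] := paramK iu.
    rewrite field_of_chartE // uK /W -scalemxAl -mulmxA.
    have [kap Eu] := split du.
    have := spectral_mxP (lam_distinct (x := param i u)) Eu (~: S).
    by rewrite finset.setCK => -[_ QP _ _]; rewrite QP mulmx0 scaler0.
have torsion_defect k v w : v *m spectral S i x = 0 -> w *m spectral S i x = 0 ->
    exists X Y, [/\ vector_field X, vector_field Y &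
    torsion k A X Y i x *m spectral S i x =
      iter k (torsion_step (A i x)) (bracket_defect i x P) v w].
  move=> /ext[X [vX Xv dX XP]] /ext[Y [vY Yw dY YP]]; exists X, Y; split=> //.
  by rewrite -Px -Xv -Yw; exact: torsion_bracket_defect.
apply: (iter_torsion_step_inj inj E (m := m)).
- by move=> e a u v; apply: bracket_defect_linearl.
- by move=> e a u v; apply: bracket_defect_linearr.
- move=> v w vP wP; have [X [Y [_ _ /= D0]]] := torsion_defect 0%N v w vP wP.
  by rewrite -[bracket_defect _ _ _ _ _]D0; exact: submxMl.
- move=> v w vP wP; have [X [Y [vX vY <-]]] := torsion_defect m v w vP wP.
  by rewrite torsion_eq0 // mul0mx.
Qed.

(** In a frame [sigma] with [sigma u *m pi = 1%:M] the bracket of two fields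
    [h *m sigma] and [k *m sigma] with constant [h] and [k] is annihilated by [pi];
    by involutivity it also lies in the distribution, on which [pi] is injective.
    Hence these fields commute, which is the integrability condition of the total
    differential equation [dg = sigma (g)]. *)
Lemma integrable_spectral (S : {set 'I_s}) (D : chart M -> M -> 'M[R]_n) :
  (forall i x, dom i x -> (D i x :=: spectral (~: S) i x)%MS) ->
  integrable_distribution D.
Proof.
move=> HD p; have [i di] := dom_cover p.
have oU : open (chart_image i) by exact: coord_open.
have Up : chart_image i (coord i p) by exact: chart_image_coord.
pose P u := spectral S i (param i u); pose Q u := spectral (~: S) i (param i u).
have CP k : Ck_on k (chart_image i) P by exact: spectral_smooth.
have CQ k : Ck_on k (chart_image i) Q by exact: spectral_smooth.
have QP u : chart_image i u -> Q u *m P u = 0.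
  move=> /paramK[_ du]; have [kap E] := split du.
  have := spectral_mxP (lam_distinct (x := param i u)) E (~: S).
  by rewrite finset.setCK => -[].
have [rk Hrk] := rank_constant S.
pose r := \rank (Q (coord i p)).
have Qr j x : dom j x -> \rank (spectral (~: S) j x) = r.
  by move=> dx; rewrite Hrk // /r /Q coordK // Hrk.
(* [pi] inverts a basis of the distribution at [p], hence is injective on the
   distribution near [p]; it serves to normalize the frame [W *m Q]. *)
pose B := row_base (Q (coord i p)).
have /submxP[W HW] : (B <= Q (coord i p))%MS by rewrite eq_row_base.
pose pi := pinvmx B.
have Bpi : B *m pi = 1%:M by apply: mulmxVp; exact: row_base_free.
pose G u := W *m Q u *m pi.
have CG k : Ck_on k (chart_image i) G.
  apply: (Ck_on_mulmx oU); last exact: Ck_on_cst.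
  by apply: (Ck_on_mulmx oU) => //; exact: Ck_on_cst.
pose V := [set u | chart_image i u /\ G u \in unitmx].
have oV : open V.
  rewrite openE => u [iu Gu].
  have n1 : \forall v \near u, chart_image i v by exact: open_nbhs_nbhs.
  have n2 : \forall v \near u, \det (G v) != 0.
    have d0 : \det (G u) != 0 by rewrite -unitfE -unitmxE.
    have cd : {for u, continuous (fun v => \det (G v))} by exact: (Ck_on_det oU (CG 0%N)).
    exact: cd [set t | t != 0] (open_nbhs_nbhs (conj (@open_neq _ _) d0)).
  by apply: filterS2 n1 n2 => v iv; rewrite /V /= unitmxE unitfE.
have Vp : V (coord i p).
  by split=> //; rewrite /G -HW Bpi unitmx1.
have VU : V `<=` chart_image i by move=> u [].
pose sigma u := invmx (G u) *m W *m Q u.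
have Csigma k : Ck_on k V sigma.
  apply: (Ck_on_mulmx oV); last exact: Ck_on_subset VU (CQ k).
  apply: (Ck_on_mulmx oV); last exact: Ck_on_cst.
  by apply: (Ck_on_invmx oV) => [u []//|]; exact: Ck_on_subset VU (CG k).
have sigma_pi u : V u -> sigma u *m pi = 1%:M.
  by move=> [_ Gu]; rewrite /sigma -!mulmxA [W *m _]mulmxA mulVmx.
have sigma_P u : V u -> sigma u *m P u = 0.
  by move=> [iu _]; rewrite /sigma -mulmxA QP // mulmx0.
have sigma_free u : V u -> row_free (sigma u).
  by move=> Vu; apply/row_freeP; exists pi; exact: sigma_pi.
have sigma_Q u : V u -> (sigma u :=: Q u)%MS.
  move=> Vu; apply/eqmxP; have sQ : (sigma u <= Q u)%MS by exact: submxMl.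
  rewrite -(geq_leqif (mxrank_leqif_eq sQ)) (Qr i) ?(eqP (sigma_free u Vu)) //.
  by have [] := paramK (VU _ Vu).
have sigma_sym u : V u -> forall h k : 'rV[R]_r,
    k *m 'D_(h *m sigma u) sigma u = h *m 'D_(k *m sigma u) sigma u.
  move=> Vu h k; have [uK du] := paramK (VU _ Vu).
  have nV : \forall v \near u, V v by exact: open_nbhs_nbhs.
  have ds : differentiable sigma u by exact: (Csigma 1%N).1.
  have dP : differentiable P u by exact: (CP 1%N).1 _ (VU _ Vu).
  have DsP v : 'D_v sigma u *m P u = - (sigma u *m 'D_v P u).
    have := derive_mulmx v ds dP; rewrite (near_eq_derive (g := cst 0)); last first.
      by apply: filterS nV => w; exact: sigma_P.
    by rewrite derive_cst => /eqP; rewrite eq_sym addr_eq0 => /eqP.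
  have Dspi v : 'D_v sigma u *m pi = 0.
    have := derive_mulmx v ds (differentiable_cst pi u).
    rewrite (near_eq_derive (g := cst 1%:M)); last by apply: filterS nV => w;
      exact: sigma_pi.
    by rewrite !derive_cst mulmx0 addr0.
  have inv : h *m sigma u *m 'D_(k *m sigma u) P u - k *m sigma u *m 'D_(h *m sigma u)
    P u = 0.
    have := @involutive S i (param i u) (h *m sigma u) (k *m sigma u) du.
    rewrite /bracket_defect uK; apply.
      by rewrite -mulmxA (sigma_P u Vu) mulmx0.
    by rewrite -mulmxA (sigma_P u Vu) mulmx0.
  have := (DsP (h *m sigma u), DsP (k *m sigma u)).
  have := (Dspi (h *m sigma u), Dspi (k *m sigma u)); move: inv.
  move: ('D_(h *m sigma u) sigma u) ('D_(k *m sigma u) sigma u) => Sh Sk.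
  move: ('D_(h *m sigma u) P u) ('D_(k *m sigma u) P u) => Ph Pk inv [Shpi Skpi] [ShP
    SkP].
  have wP : (k *m Sh - h *m Sk) *m P u = 0.
    rewrite mulmxBl -(mulmxA k) ShP -(mulmxA h) SkP !mulmxN opprK addrC (mulmxA h)
      (mulmxA k).
    exact: inv.
  have [kap E] := split du.
  have : (k *m Sh - h *m Sk <= sigma u)%MS.
    rewrite (sigma_Q u Vu) -(spectral_mx_ker (lam_distinct (x := param i u)) E).
    by apply/eqP.
  move=> /submxP[t wt]; apply/eqP; rewrite -subr_eq0 wt; apply/eqP.
  suff -> : t = 0 by rewrite mul0mx.
  have := congr1 (mulmxr pi) wt; rewrite /= -mulmxA (sigma_pi u Vu) mulmx1 => <-.
  by rewrite mulmxBl -(mulmxA k) Shpi -(mulmxA h) Skpi !mulmx0 subrr.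
have [e [g [e0 g0 Hg]]] := frobenius_parametrization oV Vp Csigma sigma_pi sigma_sym.
pose U := [set t : 'rV[R]_r | `|t| < e].
have oUt : open U.
  rewrite (_ : U = ball (0 : 'rV[R]_r) e); first exact: ball_open.
  by rewrite -ball_normE; apply/seteqP; split=> t /=; rewrite sub0r normrN.
have VgU t : U t -> V (g t) by move=> /Hg[].
have Cg k : Ck_on k U g.
  by apply: (frobenius_smooth oV Csigma) => t /Hg[].
exists r, U, (fun t => param i (g t)); split; last first.
  by exists 0; [rewrite /U /= normr0|rewrite g0 coordK].
have cgM t : U t -> {for t, continuous (fun t => param i (g t))}.
  move=> Ut; apply: continuous_comp; first exact: (Cg 0%N).
  by apply: param_continuous; exact: VU (VgU t Ut).
split=> //.
- move=> t t' Ut Ut' E.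
  have [Vt pit _ _] := Hg t Ut; have [Vt' pit' _ _] := Hg t' Ut'.
  have Eg : g t = g t'.
    by rewrite -(paramK (VU _ Vt)).1 E (paramK (VU _ Vt')).1.
  by move: pit; rewrite Eg pit' => /addrI.
- move=> j k.
  have oW : open (U `&` (fun t => param i (g t)) @^-1` dom j).
    rewrite openE => t [Ut jt].
    have n1 : \forall v \near t, U v by exact: open_nbhs_nbhs.
    have n2 : \forall v \near t, dom j (param i (g v)).
      exact: (cgM t Ut) (open_nbhs_nbhs (conj (@dom_open _ _ M j) jt)).
    exact: filterS2 n1 n2.
  have gW t : (U `&` (fun t => param i (g t)) @^-1` dom j) t -> chart_overlap i j (g t).
    by move=> [Ut jt]; apply/chart_overlapP; split=> //; exact: VU (VgU t Ut).
  have CgW : Ck_on k (U `&` (fun t => param i (g t)) @^-1` dom j) g.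
    by apply: Ck_on_subset (Cg k) => t [].
  have CT : Ck_on k (chart_overlap i j) (coord j \o param i) by exact: transition_smooth.
  exact: (Ck_on_comp_mx oW (@chart_overlap_open _ _ M i j) gW CgW CT).
- move=> j t Ut jt.
  have [Vt _ dg Dg] := Hg t Ut; have [gK igt] := paramK (VU _ Vt).
  set x := param i (g t) in jt igt gK *.
  have dT := transition_differentiable igt jt; rewrite gK in dT.
  have JE : jacobian (coord j \o (fun t => param i (g t))) t = sigma (g t) *m
    transition_jacobian i j x.
    have -> : coord j \o (fun t => param i (g t)) = (coord j \o param i) \o g by [].
    have Jg : jacobian g t = sigma (g t).
      by apply/row_matrixP => a;
        rewrite (rowE _ (jacobian _ _)) (mul_jacobian _ dg) Dg -rowE.
    by rewrite (jacobian_comp dg dT) Jg /transition_jacobian gK.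
  have JK : transition_jacobian i j x *m transition_jacobian j i x = 1%:M.
    by rewrite -transition_jacobian_comp // transition_jacobian_id.
  have free : row_free (sigma (g t) *m transition_jacobian i j x).
    apply/row_freeP; exists (transition_jacobian j i x *m pi).
    by rewrite -mulmxA [X in _ *m X]mulmxA JK mul1mx sigma_pi.
  rewrite JE; split=> //.
  have QJ : Q (g t) *m transition_jacobian i j x = transition_jacobian i j x *m
    spectral (~: S) j x.
    rewrite /Q -/x; exact: spectral_mx_conj (A_op.1 i j x igt jt).
  have sub : (sigma (g t) *m transition_jacobian i j x <= spectral (~: S) j x)%MS.
    by rewrite /sigma -mulmxA QJ !mulmxA submxMl.
  apply/eqmxP; apply: eqmx_trans (eqmx_sym (HD j x jt)); apply/eqmxP.
  by rewrite -(geq_leqif (mxrank_leqif_eq sub)) (Qr j x jt) (eqP free).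
Qed.

Lemma integrable_sum_eigen_distribution (S : {set 'I_s}) :
  integrable_distribution (fun (i : chart M) (x : M) =>
    (\sum_(k in S) eigen_distribution A (lam k) (rho k) i x)%MS).
Proof. by apply: (@integrable_spectral S) => i x; exact: distribution_spectral. Qed.

Lemma integrable_eigen_distribution (k : 'I_s) :
  integrable_distribution (eigen_distribution A (lam k) (rho k)).
Proof.
apply: (@integrable_spectral [set k]) => i x dx.
apply: eqmx_trans (distribution_spectral [set k] dx).
by apply/eqmxP; rewrite big_set1 submx_refl.
Qed.

End Integrability.

Theorem theorem40 (R : realType) (n : nat) (M : smooth_manifold R n)
    (A : chart M -> M -> 'M[R]_n) (A_op : operator_field A)
    (s : nat) (lam : 'I_s -> M -> R) (rho : 'I_s -> M -> nat)
    (lam_continuous : forall k, continuous (lam k))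
    (lam_distinct : forall x : M, injective (fun k => lam k x))
    (lam_spectrum : forall (i : chart M) (x : M), dom i x ->
       forall z : complex R, eigenvalue (map_mx (real_complex R) (A i x)) z
         <-> exists k : 'I_s, z = real_complex R (lam k x))
    (rho_riesz : forall (k : 'I_s) (i : chart M) (x : M), dom i x ->
       riesz_index (A i x - (lam k x)%:M) (rho k x))
    (rho_locally_constant : forall (k : 'I_s) (x : M),
       \forall y \near x, rho k y = rho k x)
    (eigen_constant_rank : forall k : 'I_s,
       constant_rank (eigen_distribution A (lam k) (rho k)))
    (m : nat) (m_ge1 : (1 <= m)%N)
    (torsion_eq0 : forall X Y : chart M -> M -> 'rV[R]_n,
       vector_field X -> vector_field Y ->
       forall (i : chart M) (x : M), dom i x -> torsion m A X Y i x = 0) :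
  (forall k : 'I_s,
     integrable_distribution (eigen_distribution A (lam k) (rho k))) /\
  (forall S : {set 'I_s},
     integrable_distribution (fun (i : chart M) (x : M) =>
       (\sum_(k in S) eigen_distribution A (lam k) (rho k) i x)%MS)).
Proof.
split=> [k|S].
- exact: (integrable_eigen_distribution A_op lam_continuous lam_distinct
    lam_spectrum rho_riesz eigen_constant_rank torsion_eq0).
- exact: (integrable_sum_eigen_distribution A_op lam_continuous lam_distinct
    lam_spectrum rho_riesz eigen_constant_rank torsion_eq0).
Qed.
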